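(* Let $0<q<1$. Define the generating function $$\Phi_0(x,y,z):=\sum_{k,r,s=0}^{\infty}\left\{\sum_{\substack{\boldsymbol{k}\ \text{admissible}\\ |\boldsymbol{k}|=k,\ \mathrm{dep}\,\boldsymbol{k}=r,\ \mathrm{ht}\,\boldsymbol{k}=s}}\zeta_q(\boldsymbol{k})\right\}x^{k-r-s}y^{r-s}z^{s-1}.$$ Then, as formal power series in $x,y,z$, $$1+(z-xy)\Phi_0(x,y,z)=\exp\left(\sum_{n=2}^{\infty}\zeta_q(n)\sum_{m=0}^{\infty}\frac{(q-1)^m}{m+n}\left(x^{m+n}+y^{m+n}-(\alpha^{m+n}+\beta^{m+n})\right)\right),$$ where $\alpha^{m+n}+\beta^{m+n}$ is the polynomial in $x,y,z$ determined by $$\alpha+\beta=x+y+(q-1)(z-xy),\qquad \alpha\beta=z.$$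
   Context: Fix $0<q<1$ and let $[n]:=\frac{1-q^n}{1-q}$. An index is a finite sequence of positive integers $\boldsymbol{k}=(k_1,\dots,k_r)$. Its weight is $|\boldsymbol{k}|:=k_1+\dots+k_r$, its depth is $\mathrm{dep}\,\boldsymbol{k}:=r$, and its height is $\mathrm{ht}\,\boldsymbol{k}:=\#\{j\mid k_j\ge 2\}$. The index is admissible if $k_1\ge 2$. For an admissible index, the $q$-multiple zeta value is the absolutely convergent series $$\zeta_q(k_1,\dots,k_r):=\sum_{n_1>n_2>\dots>n_r>0}\frac{q^{n_1(k_1-1)+n_2(k_2-1)+\cdots+n_r(k_r-1)}}{[n_1]^{k_1}[n_2]^{k_2}\cdots[n_r]^{k_r}}.$$ A triple $(k,r,s)$ for which there is no admissible index of weight $k$, depth $r$ and height $s$ contributes $0$; hence only non-negative powers of $x,y,z$ occur in $\Phi_0$. The symbols $\alpha,\beta$ enter only through symmetric expressions $\alpha^N+\beta^N$, which are polynomials in $\alpha+\beta$ and $\alpha\beta$, hence in $x,y,z$. *)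

(* Defs.v *)
From HB Require Import structures.
From mathcomp Require Import all_boot all_order all_algebra.
From mathcomp Require Import all_classical all_reals all_analysis.
From mathcomp Require Import zify ring.
Set Implicit Arguments.
Unset Strict Implicit.
Unset Printing Implicit Defensive.
Import Order.TTheory GRing.Theory Num.Theory.
Local Open Scope classical_set_scope.
Local Open Scope ring_scope.

(** * Formal power series *)

(* A record rather than an alias of [nat -> R], which already carries the
   pointwise product. *)
Record fps (R : Type) := Fps { fcoef :> nat -> R }.

Section UnivariateFps.
Variable R : comNzRingType.
Implicit Types f g h : fps R.

Lemma fcoefK : cancel (@fcoef R) (@Fps R). Proof. by case. Qed.

HB.instance Definition _ := Choice.copy (fps R) (can_type fcoefK).

Lemma fpsP f g : (forall n, f n = g n) -> f = g.
Proof. by case: f g => [f] [g] /= fg; congr Fps; apply/funext. Qed.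

Definition fps_zero : fps R := Fps (fun=> 0).
Definition fps_add f g : fps R := Fps (fun n => f n + g n).
Definition fps_opp f : fps R := Fps (fun n => - f n).

Lemma fps_addA : associative fps_add.
Proof. by move=> f g h; apply: fpsP => n /=; rewrite addrA. Qed.
Lemma fps_addC : commutative fps_add.
Proof. by move=> f g; apply: fpsP => n /=; rewrite addrC. Qed.
Lemma fps_add0 : left_id fps_zero fps_add.
Proof. by move=> f; apply: fpsP => n /=; rewrite add0r. Qed.
Lemma fps_addN : left_inverse fps_zero fps_opp fps_add.
Proof. by move=> f; apply: fpsP => n /=; rewrite addNr. Qed.

HB.instance Definition _ :=
  GRing.isZmodule.Build (fps R) fps_addA fps_addC fps_add0 fps_addN.

Definition fpsC (c : R) : fps R := Fps (fun n => if n == 0%N then c else 0).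
Definition fps_mul f g : fps R :=
  Fps (fun n => \sum_(i < n.+1) f i * g (n - i)%N).

Definition fps_trunc (N : nat) f : {poly R} := \poly_(i < N.+1) f i.

Lemma fps_mul_trunc N f g n : (n <= N)%N ->
  fps_mul f g n = (fps_trunc N f * fps_trunc N g)`_n.
Proof.
move=> nN; rewrite coefM /=; apply: eq_bigr => i _.
rewrite !coef_poly !ltnS (leq_trans (leq_subr _ _) nN).
by rewrite (leq_trans _ nN) // -ltnS.
Qed.

Lemma fps_mulC : commutative fps_mul.
Proof. by move=> f g; apply: fpsP => n; rewrite !(@fps_mul_trunc n) // mulrC. Qed.

Lemma fps_mulA : associative fps_mul.
Proof.
move=> f g h; apply: fpsP => n.
transitivity ((fps_trunc n f * (fps_trunc n g * fps_trunc n h))`_n).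
  rewrite coefM; apply: eq_bigr => i _.
  by rewrite coef_poly ltn_ord -(@fps_mul_trunc n) // leq_subr.
rewrite mulrA coefM; apply: eq_bigr => i _.
by rewrite coef_poly ltnS leq_subr -(@fps_mul_trunc n) // -ltnS.
Qed.

Lemma fps_mul1 : left_id (fpsC 1) fps_mul.
Proof.
move=> f; apply: fpsP => n /=; rewrite big_ord_recl /= mul1r subn0.
by rewrite big1 ?addr0 // => i _; rewrite mul0r.
Qed.

Lemma fps_mulDl : left_distributive fps_mul fps_add.
Proof.
move=> f g h; apply: fpsP => n /=; rewrite -big_split.
by apply: eq_bigr => i _; rewrite mulrDl.
Qed.

Lemma fps_oner_neq0 : fpsC 1 != 0.
Proof. by apply/eqP => /(congr1 (fun f : fps R => f 0)) /eqP; rewrite oner_eq0. Qed.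

HB.instance Definition _ := GRing.Zmodule_isComNzRing.Build (fps R)
  fps_mulA fps_mulC fps_mul1 fps_mulDl fps_oner_neq0.

Definition fpsX : fps R := Fps (fun n => (n == 1%N)%:R).

End UnivariateFps.

(* R[[x,y,z]] as R[[z]][[y]][[x]]: for [f : fps3 R], [f a b c] is the
   coefficient of x^a y^b z^c. *)
Definition fps3 (R : comNzRingType) : comNzRingType := fps (fps (fps R)).

Section TrivariateFps.
Variable R : comNzRingType.

Definition fps3_of (u : nat -> nat -> nat -> R) : fps3 R :=
  Fps (fun a => Fps (fun b => Fps (fun c => u a b c))).

Definition fps3C (c : R) : fps3 R := fpsC (fpsC (fpsC c)).
Definition fps3x : fps3 R := fpsX (fps (fps R)).
Definition fps3y : fps3 R := fpsC (fpsX (fps R)).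
Definition fps3z : fps3 R := fpsC (fpsC (fpsX R)).

Lemma fps3D (f g : fps3 R) a b c : (f + g) a b c = f a b c + g a b c.
Proof. by []. Qed.

Lemma fps3N (f : fps3 R) a b c : (- f) a b c = - f a b c.
Proof. by []. Qed.

Lemma fps_sumE (S : comNzRingType) (I : Type) (r : seq I) (F : I -> fps S) n :
  (\sum_(i <- r) F i) n = \sum_(i <- r) F i n.
Proof. by apply: (big_morph (fun f : fps S => f n)). Qed.

Lemma fps3M (f g : fps3 R) a b c :
  (f * g) a b c =
  \sum_(i < a.+1) \sum_(j < b.+1) \sum_(l < c.+1)
     f i j l * g (a - i)%N (b - j)%N (c - l)%N.
Proof.
rewrite [f * g]/(fps_mul f g) /= !fps_sumE; apply: eq_bigr => i _.
by rewrite [f i * _]/(fps_mul (f i) _) /= !fps_sumE.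
Qed.

(* Sum of a family of series in which each monomial occurs in only finitely
   many members (the finitely supported sum is 0 by convention otherwise). *)
Definition fps3_sum (I : choiceType) (A : set I) (F : I -> fps3 R) : fps3 R :=
  fps3_of (fun a b c => \sum_(i \in A) F i a b c).

Definition fps3_summable (I : choiceType) (A : set I) (F : I -> fps3 R) :=
  forall a b c, finite_set (A `&` [set i | F i a b c != 0]).

End TrivariateFps.

Arguments fps3x {R}.
Arguments fps3y {R}.
Arguments fps3z {R}.

(* Meaningful for [F] with zero constant term, cf. [fps3_exp_summable]. *)
Definition fps3_exp (R : fieldType) (F : fps3 R) : fps3 R :=
  fps3_sum [set: nat] (fun j => fps3C (j`!%:R^-1) * F ^+ j).

(* alpha ^ N + beta ^ N as a polynomial in e1 = alpha + beta and
   e2 = alpha * beta, cf. [powsumE]. *)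
Fixpoint powsum2 (S : comNzRingType) (e1 e2 : S) (N : nat) : S * S :=
  if N is N'.+1 then
    let: (p, p') := powsum2 e1 e2 N' in (p', e1 * p' - e2 * p)
  else (2, e1).

Definition powsum (S : comNzRingType) (e1 e2 : S) (N : nat) : S :=
  (powsum2 e1 e2 N).1.

Lemma powsumSS (S : comNzRingType) (e1 e2 : S) N :
  powsum e1 e2 N.+2 = e1 * powsum e1 e2 N.+1 - e2 * powsum e1 e2 N.
Proof. by rewrite /powsum /=; case: (powsum2 e1 e2 N). Qed.

Lemma powsumE (S : comNzRingType) (alpha beta : S) N :
  powsum (alpha + beta) (alpha * beta) N = alpha ^+ N + beta ^+ N.
Proof.
elim/ltn_ind: N => -[_|[_|N IH]]; rewrite ?expr0 ?expr1 //.
by rewrite powsumSS !IH // !exprS; ring.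
Qed.

Lemma powsum_morph (S T : comNzRingType) (phi : {rmorphism S -> T}) e1 e2 N :
  phi (powsum e1 e2 N) = powsum (phi e1) (phi e2) N.
Proof.
elim/ltn_ind: N => -[_|[_|N IH]]; rewrite ?(rmorph_nat phi 2) //.
by rewrite !powsumSS rmorphB !rmorphM !IH.
Qed.

(* In particular [alpha] and [beta] may live in any extension of [S]. *)
Lemma powsum_ext (S T : comNzRingType) (phi : {rmorphism S -> T}) e1 e2
    (alpha beta : T) N :
  alpha + beta = phi e1 -> alpha * beta = phi e2 ->
  phi (powsum e1 e2 N) = alpha ^+ N + beta ^+ N.
Proof. by move=> h1 h2; rewrite powsum_morph -h1 -h2 powsumE. Qed.

(** * q-multiple zeta values *)

Definition is_index (k : seq nat) : bool := all (leq 1) k.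
Definition weight (k : seq nat) : nat := sumn k.
Definition depth (k : seq nat) : nat := size k.
Definition height (k : seq nat) : nat := count (leq 2) k.
Definition admissible (k : seq nat) : bool := is_index k && (1 < head 0 k)%N.

Definition qnat (R : realType) (q : R) (n : nat) : R := (1 - q ^+ n) / (1 - q).

Definition qzeta_term (R : realType) (q : R) (k n : seq nat) : R :=
  \prod_(p <- zip k n) (q ^+ (p.2 * p.1.-1) / qnat q p.2 ^+ p.1).

(* The terms are nonnegative for 0 < q < 1, so the unordered sum of extended
   reals is the absolutely convergent sum; it is finite for admissible [k]. *)
Definition qzeta (R : realType) (q : R) (k : seq nat) : R :=
  fine (\esum_(n in [set n : seq nat |
          [&& size n == size k, sorted gtn n & all (leq 1) n]])
        (qzeta_term q k n)%:E).

Definition admissible_set (k r s : nat) : set (seq nat) :=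
  [set i | [/\ admissible i, weight i = k, depth i = r & height i = s]].

Definition qzeta_sum (R : realType) (q : R) (k r s : nat) : R :=
  \sum_(i \in admissible_set k r s) qzeta q i.

(* The truncated subtractions are harmless: [qzeta_sum q k r s] vanishes unless
   1 <= s <= r and r + s <= k, cf. [admissible_set_bounds] and
   [Phi0_summable]. *)
Definition Phi0_term (R : realType) (q : R) (t : nat * nat * nat) : fps3 R :=
  let: (k, r, s) := t in
  fps3C (qzeta_sum q k r s) *
    (fps3x ^+ (k - r - s) * fps3y ^+ (r - s) * fps3z ^+ (s - 1)).

Definition Phi0 (R : realType) (q : R) : fps3 R :=
  fps3_sum [set: nat * nat * nat] (Phi0_term q).

(** * Summability of the families above *)

Lemma admissible_set_finite k r s : finite_set (admissible_set k r s).
Proof.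
apply: (@sub_finite_set _ _
  ((fun b : k.-bseq 'I_k.+1 => [seq val j | j <- b]) @` [set: k.-bseq 'I_k.+1])).
  move=> i [/andP[ipos _] wi _ _].
  have [szi bi] : (size i <= k)%N /\ all (fun j => j < k.+1)%N i.
    rewrite -wi /weight; move: ipos {wi}; rewrite /is_index.
    elim: i => //= j i IH /andP[j0 /IH [si ai]]; split.
      by rewrite -add1n leq_add.
    rewrite ltnS leq_addr /=; apply: sub_all ai => l /=; rewrite !ltnS => h.
    exact: leq_trans h (leq_addl _ _).
  have szp : (size (pmap (insub : nat -> option 'I_k.+1) i) <= k)%N.
    by rewrite size_pmap_sub (leq_trans (count_size _ _)).
  exists (Bseq szp) => //=.
  elim: i bi {szi szp ipos wi} => //= j i IH /andP[jk /IH ij].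
  by rewrite insubT /= ij.
exact: finite_image.
Qed.

Lemma admissible_set_bounds k r s i : admissible_set k r s i ->
  [/\ (1 <= s)%N, (s <= r)%N & (r + s <= k)%N].
Proof.
case=> /andP[ipos hi] <- <- <-; split; last 1 first.
- move: ipos; rewrite /is_index /depth /height /weight {hi}.
  elim: i => //= j i IH /andP[j0 /IH]; rewrite addSn addnCA => h.
  apply: (@leq_ltn_trans ((1 < j) + sumn i)); first by rewrite leq_add2l.
  by rewrite ltn_add2r; case: j j0 => [|[]].
- by case: i hi {ipos} => //= j i j1; rewrite /height /= j1.
- exact: count_size.
Qed.

Section Order.
Variable R : comNzRingType.
Implicit Types f g : fps3 R.

Definition fps3_order_ge (d : nat) f : Prop :=
  forall a b c, (a + b + c < d)%N -> f a b c = 0.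

Lemma fps3_order_geW d e f : (d <= e)%N -> fps3_order_ge e f -> fps3_order_ge d f.
Proof. by move=> de h a b c ad; apply: h; apply: leq_trans de. Qed.

Lemma fps3_order_geD d f g :
  fps3_order_ge d f -> fps3_order_ge d g -> fps3_order_ge d (f + g).
Proof. by move=> hf hg a b c ad; rewrite fps3D hf // hg // addr0. Qed.

Lemma fps3_order_geN d f : fps3_order_ge d f -> fps3_order_ge d (- f).
Proof. by move=> hf a b c ad; rewrite fps3N hf // oppr0. Qed.

Lemma fps3_order_geM d e f g :
  fps3_order_ge d f -> fps3_order_ge e g -> fps3_order_ge (d + e) (f * g).
Proof.
move=> hf hg a b c ad; rewrite fps3M.
rewrite big1 // => i _; rewrite big1 // => j _; rewrite big1 // => l _.
have [h|h] := ltnP (i + j + l) d; first by rewrite hf // mul0r.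
rewrite hg ?mulr0 //; move: (ltn_ord i) (ltn_ord j) (ltn_ord l); lia.
Qed.

Lemma fps3_order_ge0 f : fps3_order_ge 0 f. Proof. by []. Qed.

Lemma fps3_order_geMl d f g : fps3_order_ge d g -> fps3_order_ge d (f * g).
Proof. exact: (@fps3_order_geM 0). Qed.

Lemma fps3_order_geX n f : fps3_order_ge 1 f -> fps3_order_ge n (f ^+ n).
Proof.
by move=> hf; elim: n => // n IH; rewrite exprS -add1n; apply: fps3_order_geM.
Qed.

Lemma fps3_order_ge_sum (I : choiceType) (A : set I) (F : I -> fps3 R) d :
  (forall i, A i -> fps3_order_ge d (F i)) -> fps3_order_ge d (fps3_sum A F).
Proof.
move=> h a b c ad; rewrite /= (eq_fsbigr (fun=> 0)) ?fsbig1 //.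
by move=> i /set_mem iA; apply: h.
Qed.

Lemma fps3_order_gex : fps3_order_ge 1 (fps3x : fps3 R).
Proof. by move=> [|a] // [|b] // [|c]. Qed.
Lemma fps3_order_gey : fps3_order_ge 1 (fps3y : fps3 R).
Proof. by move=> [|a] // [|b] // [|c]. Qed.
Lemma fps3_order_gez : fps3_order_ge 1 (fps3z : fps3 R).
Proof. by move=> [|a] // [|b] // [|c]. Qed.

Lemma fps3_order_ge_powsum (e1 e2 : fps3 R) N :
  fps3_order_ge 1 e1 -> fps3_order_ge 1 e2 ->
  fps3_order_ge (uphalf N) (powsum e1 e2 N).
Proof.
move=> h1 h2; elim/ltn_ind: N => -[_|[_|N IH]] //.
rewrite powsumSS; apply: fps3_order_geD; last apply: fps3_order_geN.
  apply: (@fps3_order_geW _ (1 + uphalf N.+1)); first by rewrite /=; lia.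
  by apply: fps3_order_geM => //; apply: IH.
by apply: (@fps3_order_geM 1 (uphalf N)) => //; apply: IH.
Qed.

Lemma fps3_summable_order (A : set nat) (F : nat -> fps3 R) :
  (forall n, A n -> fps3_order_ge (uphalf n) (F n)) -> fps3_summable A F.
Proof.
move=> h a b c; apply: (@sub_finite_set _ _ `I_((a + b + c).+1.*2)).
  move=> n [/= An]; apply: contra_neqT; rewrite -leqNgt => le_n.
  by apply: h => //; lia.
exact: finite_II.
Qed.

End Order.

Lemma fps3_exp_summable (R : fieldType) (F : fps3 R) : F 0 0 0 = 0 ->
  fps3_summable [set: nat] (fun j => fps3C (j`!%:R^-1) * F ^+ j).
Proof.
move=> F0; apply: fps3_summable_order => j _; apply: fps3_order_geMl.
apply: (@fps3_order_geW _ _ j); first by lia.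
by apply: fps3_order_geX => -[|a] // [|b] // [|c].
Qed.

(* The double sum in the exponent, with arbitrary coefficients [u], [v]. *)
Section ExponentSum.
Variables (R : comNzRingType) (e1 e2 : fps3 R) (u : nat -> nat -> R) (v : nat -> R).
Hypotheses (e1_ge1 : fps3_order_ge 1 e1) (e2_ge1 : fps3_order_ge 1 e2).

Let inner n m : fps3 R := fps3C (u n m) *
  (fps3x ^+ (m + n) + fps3y ^+ (m + n) - powsum e1 e2 (m + n)).
Let outer n : fps3 R := fps3C (v n) * fps3_sum [set: nat] (inner n).

Lemma inner_order_ge n m : fps3_order_ge (uphalf (m + n)) (inner n m).
Proof.
apply: fps3_order_geMl; apply: fps3_order_geD; first apply: fps3_order_geD.
- apply: (@fps3_order_geW _ _ (m + n)); first by lia.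
  exact/fps3_order_geX/fps3_order_gex.
- apply: (@fps3_order_geW _ _ (m + n)); first by lia.
  exact/fps3_order_geX/fps3_order_gey.
exact/fps3_order_geN/fps3_order_ge_powsum.
Qed.

Lemma outer_order_ge n : fps3_order_ge (uphalf n) (outer n).
Proof.
apply/fps3_order_geMl/fps3_order_ge_sum => m _.
by apply: fps3_order_geW (@inner_order_ge _ _); lia.
Qed.

Lemma inner_summable n : fps3_summable [set: nat] (inner n).
Proof.
apply: fps3_summable_order => m _.
by apply: fps3_order_geW (@inner_order_ge n m); lia.
Qed.

Lemma outer_summable : fps3_summable [set n : nat | (2 <= n)%N] outer.
Proof. by apply: fps3_summable_order => n _; exact: outer_order_ge. Qed.

Lemma outer_coef0 : fps3_sum [set n : nat | (2 <= n)%N] outer 0 0 0 = 0.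
Proof.
apply: (@fps3_order_ge_sum _ _ _ _ 1) => // n /= n2.
by apply: fps3_order_geW (@outer_order_ge n); lia.
Qed.

End ExponentSum.

Lemma fpsCM_coef (S : comNzRingType) (c : S) (f : fps S) n : (fpsC c * f) n = c * f n.
Proof.
rewrite [_ * _]/(fps_mul _ _) /= big_ord_recl /= subn0 big1 ?addr0 // => i _.
by rewrite mul0r.
Qed.

Lemma fpsXn_coef (S : comNzRingType) k n : (fpsX S ^+ k) n = (n == k)%:R.
Proof.
elim: k n => [|k IH] n; first by rewrite expr0 [LHS]/=; case: eqP.
rewrite exprS [_ * _]/(fps_mul _ _) /=.
case: n => [|n]; first by rewrite big_ord1 mul0r.
rewrite big_ord_recl big_ord_recl /= mul0r mul1r add0r big1 ?addr0; last by move=> i _; rewrite mul0r.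
by rewrite IH subSS subn0 eqSS.
Qed.

Lemma fpsCX (S : comNzRingType) (c : S) k : fpsC c ^+ k = fpsC (c ^+ k).
Proof.
elim: k => // k IH; rewrite !exprS IH; apply: fpsP => n; rewrite fpsCM_coef /=.
by case: eqP => // _; rewrite mulr0.
Qed.

Lemma fpsMC_coef (S : comNzRingType) (c : S) (f : fps S) n : (f * fpsC c) n = f n * c.
Proof. by rewrite mulrC fpsCM_coef mulrC. Qed.

Lemma fps3_monomial (R : comNzRingType) (c : R) i j l a b d :
  (fps3C c * (fps3x ^+ i * fps3y ^+ j * fps3z ^+ l)) a b d =
  c * [&& a == i, b == j & d == l]%:R.
Proof.
rewrite /fps3C !fpsCM_coef; congr (_ * _).
rewrite /fps3y /fps3z !fpsCX !fpsMC_coef !fpsXn_coef.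
rewrite (_ : (a == i)%:R = fpsC (fpsC (a == i)%:R) :> fps (fps R)); last first.
  by case: (a == i) => //; apply: fpsP => -[|?]//; apply: fpsP => -[|?].
rewrite fpsCM_coef fpsXn_coef (_ : (b == j)%:R = fpsC (b == j)%:R :> fps R).
  rewrite -mulrA !fpsCM_coef fpsXn_coef.
  by case: (a == i); case: (b == j); rewrite /= ?mul1r ?mul0r.
by case: (b == j) => //; apply: fpsP => -[|?].
Qed.

Lemma Phi0_summable (R : realType) (q : R) : fps3_summable [set: nat * nat * nat] (Phi0_term q).
Proof.
move=> a b c; apply: (@sub_finite_set _ _ [set (a + b + c + c + 2, b + c + 1, c + 1)%N]).
  move=> [[k r] s] [_ /=]; rewrite /Phi0_term fps3_monomial.
  have [ [i iA] | nA] := pselect (exists i, admissible_set k r s i).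
    have [h1 h2 h3] := admissible_set_bounds iA.
    case: and3P => [[/eqP-> /eqP-> /eqP->] _|]; last by rewrite mulr0 eqxx.
    by congr (_, _, _); lia.
  rewrite /qzeta_sum (_ : admissible_set k r s = set0) ?fsbig_set0 ?mul0r ?eqxx //.
  by apply/seteqP; split => // i iA; case: nA; exists i.
exact: finite_set1.
Qed.

(* Main.v *)
Require Import Defs.
From HB Require Import structures.
From mathcomp Require Import all_boot all_order all_algebra.
From mathcomp Require Import all_classical all_reals all_analysis.
From mathcomp Require Import zify ring lra.
Set Implicit Arguments.
Unset Strict Implicit.
Unset Printing Implicit Defensive.
Import Order.TTheory GRing.Theory Num.Theory.
Import numFieldNormedType.Exports.
Local Open Scope classical_set_scope.
Local Open Scope ring_scope.

(* Summing over the entries [k_j] first turns [1 + (z - xy) Phi_0] into a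
   q-hypergeometric series, namely Gauss' [2phi1] at the argument where it is
   summable: with [alpha], [beta] as in the theorem, its value is the product
   over [j >= 1] of the ratios
     [(1 - t_j alpha) (1 - t_j beta) / ((1 - t_j x) (1 - t_j y))],
   where [t_j = q^j / [j]_q]. Gauss' summation is proved by iterating the
   contiguity relation that shifts the lower parameter by [q]; for truncated sums
   the relation has an explicit boundary term, so the difference between the
   truncated series and the truncated product is small in a weighted l1 seminorm,
   and only one limit is needed. Finally the product is the exponential on the
   right-hand side because both satisfy the same equation [theta G = W G] for the
   Euler derivation [theta]; the sum over [m] in the exponent comes from
     [sum_(2 <= n <= N) (q-1)^(N-n) q^(j(n-1)) / [j]^n
        = t_j^N + t_j / (1-q) (q-1)^N],
   whose second term contributes nothing because the ratio above is [1] at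
   [t = q - 1]. *)

(** * Formal power series and seminorms *)

Lemma fpsBE (S : comNzRingType) (f g : fps S) n : (f - g) n = f n - g n.
Proof. by []. Qed.

Lemma fpsDE (S : comNzRingType) (f g : fps S) n : (f + g) n = f n + g n.
Proof. by []. Qed.

Lemma fpsME (S : comNzRingType) (f g : fps S) n :
  (f * g) n = \sum_(i < n.+1) f i * g (n - i)%N.
Proof. by []. Qed.

Lemma fpsC_is_zmod_morphism (S : comNzRingType) : zmod_morphism (@fpsC S).
Proof. by move=> a b; apply: fpsP => -[|n]; last exact: esym (subrr 0). Qed.

Lemma fpsC_is_monoid_morphism (S : comNzRingType) : monoid_morphism (@fpsC S).
Proof.
split=> // a b; apply: fpsP => n; rewrite fpsCM_coef /=.
by case: eqP => //; rewrite mulr0.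
Qed.

HB.instance Definition _ (S : comNzRingType) :=
  GRing.isZmodMorphism.Build S (fps S) (@fpsC S) (@fpsC_is_zmod_morphism S).
HB.instance Definition _ (S : comNzRingType) :=
  GRing.isMonoidMorphism.Build S (fps S) (@fpsC S) (@fpsC_is_monoid_morphism S).

Lemma fps3C_is_zmod_morphism (R : comNzRingType) : zmod_morphism (@fps3C R).
Proof. by move=> a b; rewrite /fps3C !rmorphB. Qed.

Lemma fps3C_is_monoid_morphism (R : comNzRingType) : monoid_morphism (@fps3C R).
Proof.
split=> [|a b]; rewrite /fps3C; first by rewrite !rmorph1.
rewrite (rmorphM (@fpsC R)) (rmorphM (@fpsC (fps R))).
exact: (rmorphM (@fpsC (fps (fps R)))).
Qed.

HB.instance Definition _ (R : comNzRingType) :=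
  GRing.isZmodMorphism.Build R (fps3 R) (@fps3C R) (@fps3C_is_zmod_morphism R).
HB.instance Definition _ (R : comNzRingType) :=
  GRing.isMonoidMorphism.Build R (fps3 R) (@fps3C R) (@fps3C_is_monoid_morphism R).

Definition fps_geo (S : comNzRingType) (c : S) : fps S := Fps (fun n => c ^+ n).

Lemma fps_geoK (S : comNzRingType) (c : S) : (1 - fpsC c * fpsX S) * fps_geo c = 1.
Proof.
apply: fpsP => n; rewrite mulrBl mul1r -mulrA fpsBE fpsCM_coef fpsME.
case: n => [|n]; first by rewrite big_ord1 mul0r mulr0 subr0.
rewrite big_ord_recl big_ord_recl big1 => [|i _]; last by rewrite mul0r.
by rewrite mul0r mul1r add0r addr0 subSS subn0 [fps_geo c n.+1]exprS subrr.
Qed.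

Section Geo.
Variable R : comNzRingType.
Implicit Type t : R.

Definition geox t : fps3 R := fps_geo (fpsC (fpsC t)).
Definition geoy t : fps3 R := fpsC (fps_geo (fpsC t)).

Lemma geoxK t : (1 - fps3C t * fps3x) * geox t = 1.
Proof. exact: fps_geoK. Qed.

Lemma geoyK t : (1 - fps3C t * fps3y) * geoy t = 1.
Proof.
rewrite /fps3C /fps3y /geoy -rmorphM -{1}(rmorph1 (@fpsC (fps (fps R)))).
by rewrite -rmorphB -rmorphM fps_geoK.
Qed.
End Geo.

(** * Submultiplicative weighted l1 seminorms on truncated power series *)

Section Seminorm.
Variable R : realType.

Record seminorm (S : comNzRingType) (nu : S -> R) : Prop := Seminorm {
  snrm_ge0 : forall a, 0 <= nu a;
  snrm0 : nu 0 = 0;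
  snrm1 : nu 1 <= 1;
  snrmN : forall a, nu (- a) = nu a;
  snrmD : forall a b, nu (a + b) <= nu a + nu b;
  snrmM : forall a b, nu (a * b) <= nu a * nu b }.

Lemma snrm_sum (S : comNzRingType) (nu : S -> R) (hnu : seminorm nu)
    (I : Type) (r : seq I) (P : pred I) (F : I -> S) :
  nu (\sum_(i <- r | P i) F i) <= \sum_(i <- r | P i) nu (F i).
Proof.
apply: (big_ind2 (fun a b => nu a <= b)); first by rewrite snrm0.
  by move=> a a' b b' ha hb; apply: le_trans (snrmD hnu _ _) _; apply: lerD.
by [].
Qed.

Lemma snrm_prod (S : comNzRingType) (nu : S -> R) (hnu : seminorm nu)
    (I : Type) (r : seq I) (P : pred I) (F : I -> S) :
  nu (\prod_(i <- r | P i) F i) <= \prod_(i <- r | P i) nu (F i).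
Proof.
suff: 0 <= nu (\prod_(i <- r | P i) F i) <= \prod_(i <- r | P i) nu (F i) by case/andP.
apply: (big_ind2 (fun a b => 0 <= nu a <= b)); first by rewrite snrm_ge0 // snrm1.
  move=> a a' b b' /andP[a0 ha] /andP[b0 hb]; rewrite snrm_ge0 //=.
  by apply: le_trans (snrmM hnu _ _) _; apply: ler_pM.
by move=> i _; rewrite snrm_ge0 /=.
Qed.

(** The pairs [(i, n - i)] fill a triangle inside the square of all pairs, and the terms are
    nonnegative. This is what makes [wnorm] submultiplicative. *)
Lemma triangle_sum_le (h : nat -> nat -> R) (D : nat) : (forall i j, 0 <= h i j) ->
  \sum_(n < D) \sum_(i < n.+1) h i (n - i)%N <= \sum_(i < D) \sum_(j < D) h i j.
Proof.
move=> h0.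
have -> : \sum_(n < D) \sum_(i < n.+1) h i (n - i)%N =
   \sum_(n < D) \sum_(i < D | (i <= n)%N) h i (n - i)%N.
  apply: eq_bigr => n _.
  by rewrite (big_ord_widen_cond D xpredT (fun i => h i (n - i)%N)) //=.
rewrite (exchange_big_dep xpredT) //=; apply: ler_sum => i _.
rewrite -(big_mkord (fun n => (i <= n)%N) (fun n => h i (n - i)%N)).
rewrite -(big_mkord xpredT (h i)) (@big_cat_nat _ _ _ i) //=; last exact: ltnW.
rewrite big_nat_cond big1 ?add0r; last by move=> n; lia.
rewrite -{1}(add0n i) big_addn.
rewrite (@big_cat_nat _ _ _ (D - i) 0 D) ?leq_subr //= big_mkcond /=.
rewrite -[leLHS]addr0 lerD ?sumr_ge0 //; apply: ler_sum => j _.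
by rewrite addnK; case: ifP.
Qed.

(** Cutting at degree [D] makes the norm finite on every series. Submultiplicativity survives,
    because the coefficients of a product up to degree [D] involve only coefficients up to degree
    [D] of its factors. *)
Definition wnorm (S : comNzRingType) (nu : S -> R) (e : R) (D : nat) (f : fps S) : R :=
  \sum_(i < D.+1) nu (f i) * e ^+ i.

Lemma wnorm_seminorm (S : comNzRingType) (nu : S -> R) (e : R) D :
  0 <= e -> seminorm nu -> seminorm (wnorm nu e D).
Proof.
move=> e0 hnu; split.
- by move=> f; apply: sumr_ge0 => i _; rewrite mulr_ge0 ?exprn_ge0 ?snrm_ge0.
- by rewrite /wnorm big1 // => i _; rewrite snrm0 ?mul0r.
- rewrite /wnorm big_ord_recl big1 => [|i _]; last by rewrite snrm0 ?mul0r.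
  by rewrite expr0 mulr1 addr0 snrm1.
- by move=> f; apply: eq_bigr => i _; rewrite [(- f) i]/(- f i) snrmN.
- move=> f g; rewrite /wnorm -big_split; apply: ler_sum => i _ /=.
  by rewrite -mulrDl ler_wpM2r ?exprn_ge0 // snrmD.
- move=> f g; rewrite /wnorm.
  pose h i j := nu (f i) * e ^+ i * (nu (g j) * e ^+ j).
  have h0 i j : 0 <= h i j by rewrite !mulr_ge0 ?exprn_ge0 ?snrm_ge0.
  apply: (@le_trans _ _ (\sum_(i < D.+1) \sum_(j < D.+1) h i j)); last first.
    by rewrite mulr_suml; apply: ler_sum => i _; rewrite mulr_sumr.
  apply: le_trans (triangle_sum_le _ h0); apply: ler_sum => n _.
  apply: (@le_trans _ _ ((\sum_(i < n.+1) nu (f i * g (n - i)%N)) * e ^+ n)).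
    by rewrite ler_wpM2r ?exprn_ge0 //; apply: snrm_sum.
  rewrite mulr_suml; apply: ler_sum => i _; rewrite /h mulrACA -exprD.
  rewrite subnKC; last by rewrite -ltnS.
  by rewrite ler_wpM2r ?exprn_ge0 // snrmM.
Qed.

Lemma wnormC (S : comNzRingType) (nu : S -> R) e D c :
  seminorm nu -> wnorm nu e D (fpsC c) = nu c.
Proof.
move=> hnu; rewrite /wnorm big_ord_recl big1 => [|i _]; last by rewrite snrm0 ?mul0r.
by rewrite expr0 mulr1 addr0.
Qed.

Lemma wnormX (S : comNzRingType) (nu : S -> R) e D :
  0 <= e -> seminorm nu -> wnorm nu e D (fpsX S) <= e.
Proof.
move=> e0 hnu; rewrite /wnorm big_ord_recl /= snrm0 // mul0r add0r.
case: D => [|D]; first by rewrite big_ord0.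
rewrite big_ord_recl /= big1 => [|i _]; last by rewrite snrm0 ?mul0r.
by rewrite expr1 addr0 ler_piMl // snrm1.
Qed.

Lemma coef_le_wnorm (S : comNzRingType) (nu : S -> R) e D (f : fps S) i :
  0 <= e -> seminorm nu -> (i <= D)%N -> nu (f i) * e ^+ i <= wnorm nu e D f.
Proof.
move=> e0 hnu iD; rewrite /wnorm (bigD1 (Ordinal (_ : i < D.+1)%N)) //= lerDl.
by apply: sumr_ge0 => j _; rewrite mulr_ge0 ?exprn_ge0 ?snrm_ge0.
Qed.

Lemma normr_seminorm : seminorm (fun c : R => `|c|).
Proof.
split=> //.
- exact: normr0.
- by rewrite normr1.
- exact: normrN.
- exact: ler_normD.
- by move=> a b; rewrite normrM.
Qed.

Definition nrm3 (e : R) (D : nat) : fps3 R -> R :=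
  wnorm (wnorm (wnorm (fun c : R => `|c|) e D) e D) e D.

Variables (e : R) (D : nat).
Hypothesis e0 : 0 <= e.

Lemma nrm3_seminorm : seminorm (nrm3 e D).
Proof. by do 3![apply: wnorm_seminorm => //]; exact: normr_seminorm. Qed.

Let h1 := normr_seminorm.
Let h2 := wnorm_seminorm D e0 h1.
Let h3 := wnorm_seminorm D e0 h2.

Lemma nrm3C c : nrm3 e D (fps3C c) = `|c|.
Proof. by rewrite /nrm3 /fps3C !wnormC. Qed.
Lemma nrm3x : nrm3 e D fps3x <= e. Proof. exact: wnormX. Qed.
Lemma nrm3y : nrm3 e D fps3y <= e.
Proof. by rewrite /nrm3 wnormC //; exact: wnormX. Qed.
Lemma nrm3z : nrm3 e D fps3z <= e.
Proof. by rewrite /nrm3 !wnormC //; exact: wnormX. Qed.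

(** Turns smallness in the seminorm into coefficientwise convergence. *)
Lemma coef_le_nrm3 (f : fps3 R) a b c : (a <= D)%N -> (b <= D)%N -> (c <= D)%N ->
  `|f a b c| * e ^+ (a + b + c) <= nrm3 e D f.
Proof.
move=> aD bD cD; apply: le_trans (coef_le_wnorm f e0 h3 aD).
have -> : `|f a b c| * e ^+ (a + b + c) = `|f a b c| * e ^+ c * e ^+ b * e ^+ a.
  by rewrite !exprD; ring.
rewrite ler_wpM2r ?exprn_ge0 //.
apply: le_trans (coef_le_wnorm (f a) e0 h2 bD).
rewrite ler_wpM2r ?exprn_ge0 //.
exact: (coef_le_wnorm (f a b) e0 h1 cD).
Qed.

End Seminorm.

(** * The q-Gauss summation *)

(* The contiguity relation divided by the summand: [c = q^(k+1)], [v = q^n] and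
   [d' = 1 / (1 - q^(k+n+1) (1 + p x))]. *)
Lemma gauss_certificate (K : comNzRingType) (c v p x y z d' : K) :
  d' * (1 - c * v * (1 + p * x)) = 1 ->
  (1 - c * (1 + p * y)) -
    v * ((1 - c * (2 + p * (x + y) - p ^+ 2 * (z - x * y)) +
          c ^+ 2 * ((1 + p * x) * (1 + p * y))) * d') =
  (1 - v) - c * ((1 - v) ^+ 2 + p * (1 - v) * y - p * v * (1 - v) * x +
                 p ^+ 2 * v * (z - x * y)) * d'.
Proof.
move=> h.
apply/eqP; rewrite -subr_eq0; apply/eqP.
transitivity ((c * (1 + p * y) - v) * (d' * (1 - c * v * (1 + p * x)) - 1)).
  by ring.
by rewrite h subrr mulr0.
Qed.

(** The left side is [(1 - w (1 + p alpha)) (1 - w (1 + p beta))], since [(1 + p alpha) (1 + p beta)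
    = (1 + p x) (1 + p y)]. By the hypothesis [1 - w (1 + p alpha) = (1 - w) (1 - t alpha)], and
    likewise for [beta]. *)
Lemma gauss_quadratic (K : comNzRingType) (w t p x y z : K) :
  (1 - w) * t = p * w ->
  1 - w * (2 + p * (x + y) - p ^+ 2 * (z - x * y)) +
    w ^+ 2 * ((1 + p * x) * (1 + p * y)) =
  (1 - w) ^+ 2 * (1 - t * (x + y - p * (z - x * y)) + t ^+ 2 * z).
Proof.
move=> h.
transitivity ((1 - w) ^+ 2 - (1 - w) * ((1 - w) * t) * (x + y - p * (z - x * y))
              + ((1 - w) * t) ^+ 2 * z); last by ring.
by rewrite h; ring.
Qed.

(** Replacing [p] and [p v] by [(1 - v) s] and [(1 - v) t] turns the first factor into
    [(1 - v)^2 ((1 + s y) (1 - t x) + s t z)], and [g] is the inverse of [1 - t x]. It is used with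
    [v = q^n] and [s = 1 / [n]]. *)
Lemma gnum_factor (K : comNzRingType) (s t v p x y z g : K) :
  (1 - v) * s = p -> (1 - v) * t = p * v -> (1 - t * x) * g = 1 ->
  ((1 - v) ^+ 2 + p * (1 - v) * y - p * v * (1 - v) * x + p ^+ 2 * v * (z - x * y)) * g
  = (1 - v) ^+ 2 * (1 + (s * y + z * (t * s * g))).
Proof.
move=> hs ht hg.
transitivity ((1 - v) ^+ 2 * ((1 + s * y) * ((1 - t * x) * g) + z * (t * s * g))); last first.
  by rewrite hg; ring.
transitivity (((1 - v) ^+ 2 + ((1 - v) * s) * (1 - v) * y - ((1 - v) * t) * (1 - v) * x
   + ((1 - v) * s) * ((1 - v) * t) * (z - x * y)) * g); last by ring.
by rewrite hs ht; ring.
Qed.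

Section TQ.
Variables (R : realType) (q : R).
Hypotheses (q0 : 0 < q) (q1 : q < 1).

Let q_ge0 : 0 <= q. Proof. exact: ltW. Qed.
Let q_le1 : q <= 1. Proof. exact: ltW. Qed.

Definition tq (n : nat) : R := q ^+ n / qnat q n.

Lemma qX_lt1 n : q ^+ n.+1 < 1. Proof. by rewrite exprn_ilt1. Qed.

Lemma qX_le n : q ^+ n.+1 <= q.
Proof. by rewrite -[leRHS]expr1 ler_wiXn2l. Qed.

Lemma qX1_gt0 n : 0 < 1 - q ^+ n.+1. Proof. by rewrite subr_gt0 qX_lt1. Qed.

Lemma p_gt0 : 0 < 1 - q. Proof. by rewrite subr_gt0. Qed.

Lemma qnat_gt0 n : 0 < qnat q n.+1.
Proof. by rewrite divr_gt0 ?qX1_gt0 ?p_gt0. Qed.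

Lemma qnat_ge1 n : 1 <= qnat q n.+1.
Proof. by rewrite ler_pdivlMr ?p_gt0 // mul1r lerB // qX_le. Qed.

(** Hence [1 - q^j (1 + (1 - q) a) = (1 - q^j) (1 - t_j a)] for every [a]: the passage from
    q-shifted factorials to the factors of the product. *)
Lemma tqE n : (1 - q ^+ n.+1) * tq n.+1 = (1 - q) * q ^+ n.+1.
Proof.
rewrite /tq /qnat; field.
by rewrite !gt_eqF ?p_gt0 ?qX1_gt0.
Qed.

Lemma tq_ge0 n : 0 <= tq n.+1.
Proof. by rewrite divr_ge0 ?exprn_ge0 // ltW // qnat_gt0. Qed.

Lemma tq_leX n : tq n.+1 <= q ^+ n.+1.
Proof.
by rewrite /tq ler_pdivrMr ?qnat_gt0 // ler_peMr ?exprn_ge0 // qnat_ge1.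
Qed.

Lemma tq_le1 n : tq n.+1 <= 1.
Proof. by apply: le_trans (tq_leX _) _; apply: ltW; apply: qX_lt1. Qed.

End TQ.

Section Gauss.
Variables (R : realType) (q : R).
Hypotheses (q0 : 0 < q) (q1 : q < 1).
Variables (K : comNzRingType) (C : {rmorphism R -> K}) (x y z : K) (gx gy : nat -> K).
Hypothesis gxK : forall n, (1 - C (tq q n.+1) * x) * gx n.+1 = 1.
Hypothesis gyK : forall n, (1 - C (tq q n.+1) * y) * gy n.+1 = 1.
Local Notation p := (1 - q).
Local Notation tq := (tq q).

Lemma C1B v : C (1 - v) = 1 - C v.
Proof. by rewrite rmorphB rmorph1. Qed.

Definition invx (n : nat) : K := C (1 - q ^+ n)^-1 * gx n.
Definition invy (n : nat) : K := C (1 - q ^+ n)^-1 * gy n.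

Lemma invxK n : invx n.+1 * (1 - C (q ^+ n.+1) * (1 + C p * x)) = 1.
Proof.
have -> : 1 - C (q ^+ n.+1) * (1 + C p * x) =
    C (1 - q ^+ n.+1) * (1 - C (tq n.+1) * x).
  rewrite mulrBr mulr1 mulrA -(rmorphM C) (tqE q0 q1) (C1B (q ^+ _)) (rmorphM C p).
  ring.
rewrite /invx mulrACA -(rmorphM C) mulVf ?gt_eqF ?(qX1_gt0 q0 q1) //.
by rewrite (rmorph1 C) mul1r mulrC gxK.
Qed.

Lemma invyK n : invy n.+1 * (1 - C (q ^+ n.+1) * (1 + C p * y)) = 1.
Proof.
have -> : 1 - C (q ^+ n.+1) * (1 + C p * y) =
    C (1 - q ^+ n.+1) * (1 - C (tq n.+1) * y).
  rewrite mulrBr mulr1 mulrA -(rmorphM C) (tqE q0 q1) (C1B (q ^+ _)) (rmorphM C p).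
  ring.
rewrite /invy mulrACA -(rmorphM C) mulVf ?gt_eqF ?(qX1_gt0 q0 q1) //.
by rewrite (rmorph1 C) mul1r mulrC gyK.
Qed.

Definition e1gauss : K := x + y + C (q - 1) * (z - x * y).

Lemma e1gaussE : e1gauss = x + y - C p * (z - x * y).
Proof.
have -> : C p = - C (q - 1) by rewrite -rmorphN opprB.
by rewrite mulNr opprK.
Qed.

(* [gnum (q^m)] is [(1 - A q^m) (1 - B q^m) (1 + p y)] for the parameters
   [A = (1 + p alpha) / (1 + p y)], [B = (1 + p beta) / (1 + p y)] of Gauss' sum. *)
Definition gnum (v : R) : K :=
  (1 - C v) ^+ 2 + C p * (1 - C v) * y - C p * C v * (1 - C v) * x
  + C p ^+ 2 * C v * (z - x * y).

(* The lower parameter of the series with index [k] is [q^(k+1) (1 + p x)]. *)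
Definition gterm (k n : nat) : K :=
  \prod_(m < n) (C (q ^+ k.+1 / (1 - q ^+ m.+1)) * gnum (q ^+ m) * invx (m.+1 + k)).

Definition gsum (k M : nat) : K := \sum_(n < M) gterm k n.

Definition qfac (n : nat) : K :=
  (1 - C (tq n) * e1gauss + C (tq n) ^+ 2 * z) * (gx n * gy n).

Lemma qfacE n : qfac n.+1 =
  (1 - C (q ^+ n.+1) * (2 + C p * (x + y) - C p ^+ 2 * (z - x * y)) +
     C (q ^+ n.+1) ^+ 2 * ((1 + C p * x) * (1 + C p * y))) * (invx n.+1 * invy n.+1).
Proof.
rewrite (@gauss_quadratic _ _ (C (tq n.+1))); last first.
  by rewrite -C1B -!(rmorphM C) (tqE q0 q1).
rewrite -e1gaussE /qfac /invx /invy.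
have U : (1 - C (q ^+ n.+1)) * C (1 - q ^+ n.+1)^-1 = 1.
  by rewrite -C1B -(rmorphM C) mulfV ?rmorph1 // gt_eqF ?(qX1_gt0 q0 q1).
move: (1 - C (q ^+ n.+1)) (C (1 - q ^+ n.+1)^-1) U => a b U.
move: (gx _) (gy _) (_ + _ * z) => g g' f.
transitivity ((a * b) ^+ 2 * (f * (g * g'))); first by rewrite U expr1n mul1r.
by ring.
Qed.

(** Raising [k] by one multiplies each of the [n] factors by [q] and shifts the window of lower
    factors by one, so only its two end factors remain. *)
Lemma gterm_shift k n :
  invx k.+1 * gterm k.+1 n = C (q ^+ n) * (invx (k.+1 + n) * gterm k n).
Proof.
elim: n => [|n IH].
  by rewrite /gterm !big_ord0 expr0 (rmorph1 C) mul1r addn0.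
rewrite /gterm !big_ord_recr /= -!/(gterm _ _) mulrA IH.
rewrite (_ : n.+1 + k.+1 = k.+1 + n.+1)%N; last lia.
rewrite (_ : n.+1 + k = k.+1 + n)%N; last lia.
rewrite !(exprS q) -!(mulrA q) !(rmorphM C q).
by ring.
Qed.

(** Contiguity relation with its boundary term. Once [invy] is cleared, the summand is a difference
    in [M] by [gauss_certificate], so induction on [M] applies. *)
Lemma gsum_step k M :
  gsum k M - qfac k.+1 * gsum k.+1 M = - (1 - C (q ^+ M)) * invy k.+1 * gterm k M.
Proof.
suff {M} main M : (1 - C (q ^+ k.+1) * (1 + C p * y)) * gsum k M -
    (1 - C (q ^+ k.+1) * (2 + C p * (x + y) - C p ^+ 2 * (z - x * y)) +
     C (q ^+ k.+1) ^+ 2 * ((1 + C p * x) * (1 + C p * y))) *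
      (invx k.+1 * gsum k.+1 M) = - (1 - C (q ^+ M)) * gterm k M.
  rewrite [RHS]mulrAC -main qfacE.
  transitivity (invy k.+1 * (1 - C (q ^+ k.+1) * (1 + C p * y)) * gsum k M -
    (1 - C (q ^+ k.+1) * (2 + C p * (x + y) - C p ^+ 2 * (z - x * y)) +
     C (q ^+ k.+1) ^+ 2 * ((1 + C p * x) * (1 + C p * y))) *
    (invx k.+1 * invy k.+1) * gsum k.+1 M); first by rewrite invyK mul1r.
  by ring.
elim: M => [|M IH].
  by rewrite /gsum !big_ord0 expr0 (rmorph1 C) !mulr0 !subrr oppr0 mul0r.
rewrite /gsum !big_ord_recr /= -!/(gsum _ _).
set a := 1 - _ * _ in IH *; set b := _ + _ ^+ 2 * _ in IH *.
rewrite (mulrDr a) (mulrDr (invx _)) (mulrDr b) opprD addrACA {}IH gterm_shift {}/a {}/b.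
have := @gauss_certificate _ (C (q ^+ k.+1)) (C (q ^+ M)) (C p) x y z (invx (k.+1 + M)).
rewrite -(rmorphM C) -exprD => /(_ (@invxK (k + M))) cert.
rewrite [RHS]mulNr.
(* The factor [1 - q^(M+1)] cancels the denominator in the last factor of [gterm k M.+1]; what is
   left is the second term on the right of [cert], times [gterm k M]. *)
have -> : (1 - C (q ^+ M.+1)) * gterm k M.+1 =
   C (q ^+ k.+1) * gnum (q ^+ M) * invx (k.+1 + M) * gterm k M.
  rewrite /gterm big_ord_recr /= -/(gterm _ _) (_ : M.+1 + k = k.+1 + M)%N; last lia.
  have U : C (1 - q ^+ M.+1)^-1 * C (1 - q ^+ M.+1) = 1.
    by rewrite -(rmorphM C) mulVf ?rmorph1 // gt_eqF ?(qX1_gt0 q0 q1).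
  move: U; rewrite (rmorphM C (q ^+ k.+1)) (C1B (q ^+ _)).
  move: (C _^-1) => i; move: (1 - C _) => j; move: (gnum _) (invx _) (gterm _ _) (C _) => a b c d U.
  by rewrite -[RHS]mul1r -U; ring.
rewrite -/(gnum _) in cert; move: cert.
set a := 1 - _ * _; set b := _ + _ ^+ 2 * _.
move: a b (gnum _) (invx _) (gterm _ _) (C _) (C _) => a b N i g c v cert.
transitivity ((a - v * (b * i)) * g - (1 - v) * g); first by ring.
by rewrite cert; ring.
Qed.

Definition qfacs (M : nat) : K := \prod_(j < M) qfac j.+1.

(** Iterating [gsum_step] makes [qfacs j * gsum j M] telescope from [j = 0] to [j = M]. The number
    of terms and the number of factors are both [M], so that a single limit remains. *)
Lemma gsum_qfacs M : gsum 0 M - qfacs M =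
  (\sum_(j < M) - (1 - C (q ^+ M)) * (qfacs j * invy j.+1 * gterm j M))
  + qfacs M * (gsum M M - 1).
Proof.
rewrite mulrBr mulr1 addrA; congr (_ - _).
have -> : \sum_(j < M) - (1 - C (q ^+ M)) * (qfacs j * invy j.+1 * gterm j M) =
    - \sum_(0 <= j < M) (qfacs j.+1 * gsum j.+1 M - qfacs j * gsum j M).
  rewrite big_mkord -sumrN; apply: eq_bigr => j _.
  rewrite opprB /qfacs big_ord_recr /= -/(qfacs j).
  transitivity (qfacs j * (gsum j M - qfac j.+1 * gsum j.+1 M)); last by ring.
  by rewrite gsum_step; ring.
by rewrite telescope_sumr // opprB {1}/qfacs big_ord0 mul1r subrK.
Qed.

(** * Seminorm estimates for the Gauss sum and the product *)

Variables (nu : K -> R) (e : R).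
Hypotheses (hnu : seminorm nu) (nuC : forall c, nu (C c) = `|c|).
Hypotheses (e0 : 0 <= e) (e2 : 2 * e <= 1).
Hypotheses (nux : nu x <= e) (nuy : nu y <= e) (nuz : nu z <= e).

Let nuD a b a' b' : nu a <= a' -> nu b <= b' -> nu (a + b) <= a' + b'.
Proof. by move=> ha hb; apply: le_trans (snrmD hnu _ _) (lerD ha hb). Qed.

Let nuB a b a' b' : nu a <= a' -> nu b <= b' -> nu (a - b) <= a' + b'.
Proof. by move=> ha hb; apply: nuD => //; rewrite (snrmN hnu). Qed.

Let nuM a b a' b' : nu a <= a' -> nu b <= b' -> nu (a * b) <= a' * b'.
Proof.
by move=> ha hb; apply: le_trans (snrmM hnu _ _) _; apply: ler_pM; rewrite // (snrm_ge0 hnu).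
Qed.

Let nuCp c : 0 <= c -> nu (C c) <= c.
Proof. by move=> c0; rewrite nuC ger0_norm. Qed.

(** From [g = 1 + t a g] follows [(1 - e) nu g <= 1], and [1 <= (1 - e) (1 + 2 e)] because
    [2 e <= 1]. *)
Lemma nu_geo t a g : 0 <= t <= 1 -> nu a <= e -> (1 - C t * a) * g = 1 ->
  nu g <= 1 + 2 * e.
Proof.
move=> /andP[t0 t1] ha hg.
have h : g = 1 + C t * a * g by rewrite -{1}hg mulrBl mul1r subrK.
have : nu g <= 1 + 1 * e * nu g.
  rewrite {1}h; apply: nuD; first exact: snrm1 hnu.
  apply: nuM => //; apply: nuM => //; apply: le_trans t1; exact: nuCp.
move: e0 e2 (nu g) => h0 h2 n hn.
rewrite -(ler_pM2r (_ : 0 < 1 - e)); last by lra.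
have : 0 <= e * (1 - 2 * e) by apply: mulr_ge0 => //; lra.
by lra.
Qed.

Lemma nu_gx n : nu (gx n.+1) <= 1 + 2 * e.
Proof. by apply: nu_geo nux (gxK n); rewrite tq_ge0 ?tq_le1. Qed.

Lemma nu_gy n : nu (gy n.+1) <= 1 + 2 * e.
Proof. by apply: nu_geo nuy (gyK n); rewrite tq_ge0 ?tq_le1. Qed.

Lemma nu_invy n : nu (invy n.+1) <= (1 - q)^-1 * (1 + 2 * e).
Proof.
apply: nuM (nu_gy n).
rewrite nuC ger0_norm ?invr_ge0 ?(ltW (qX1_gt0 _ _ _)) //.
by rewrite lef_pV2 ?posrE ?(p_gt0 q1) ?(qX1_gt0 q0 q1) // lerB // (qX_le q0 q1).
Qed.

(** Every term of [gnum] contains two factors among [1 - v] and [p], whence the square of [a]; that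
    square later cancels the denominators of [gterm]. *)
Lemma nu_gnum v a : 0 <= v <= 1 -> 1 - q <= a -> 1 - v <= a ->
  nu (gnum v) <= a ^+ 2 * (1 + 5 * e).
Proof.
move=> /andP[v0 v1] pa va.
have p0 := ltW (p_gt0 q1).
have hv : nu (1 - C v) <= 1 - v by rewrite -C1B; apply: nuCp; rewrite subr_ge0.
have hzxy : nu (z - x * y) <= e + e * e by apply: nuB => //; exact: nuM.
apply: (@le_trans _ _ ((1 - v) * (1 - v) + p * (1 - v) * e + p * v * (1 - v) * e
    + p * p * v * (e + e * e))).
  by rewrite /gnum !expr2; apply: nuD; first (apply: nuB; first apply: nuD);
    do ![apply: nuM => //]; apply: nuCp.
have s0 : 0 <= 1 - v by rewrite subr_ge0.
have a0 : 0 <= a by apply: le_trans pa.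
have h1 : (1 - v) * (1 - v) <= a * a by apply: ler_pM.
have h2 : p * (1 - v) <= a * a by apply: ler_pM.
have h3 : p * p <= a * a by apply: ler_pM.
have h4 : p * v * (1 - v) <= a * a.
  by apply: le_trans h2; rewrite mulrAC ler_piMr // mulr_ge0.
have h5 : p * p * v <= a * a by apply: le_trans h3; rewrite ler_piMr // mulr_ge0.
have -> : a ^+ 2 * (1 + 5 * e) = a * a + a * a * e + a * a * e + a * a * (3 * e).
  by ring.
apply: lerD; first apply: lerD; first apply: lerD => //.
- by rewrite ler_wpM2r.
- by rewrite ler_wpM2r.
apply: ler_pM => //; first by rewrite !mulr_ge0.
  by rewrite addr_ge0 ?mulr_ge0.
by move: e0 e2 => ? ?; nra.
Qed.

(** A common bound for [qfac], for [1 + step], and, up to [q^(k+1)], for each factor of [gterm k].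
    It tends to 1 with [e], so [kappa * q < 1] can be achieved. *)
Definition kappa : R := (1 + 5 * e) * ((1 + 2 * e) * (1 + 2 * e)).

Lemma nu_qfac n : nu (qfac n.+1) <= kappa.
Proof.
apply: nuM; last exact: nuM (nu_gx n) (nu_gy n).
have p0 := ltW (p_gt0 q1).
have p1 : p <= 1 by rewrite gerBl ltW.
have hp : nu (C p) <= 1 by apply: le_trans p1; exact: nuCp.
have ht : nu (C (tq n.+1)) <= 1.
  by apply: le_trans (tq_le1 q0 q1 n); apply: nuCp; apply: tq_ge0.
have h1 : nu 1 <= 1 by exact: snrm1.
rewrite e1gaussE expr2.
apply: (@le_trans _ _ (1 + 1 * (e + e + 1 * (e + e * e)) + 1 * 1 * e)).
  apply: nuD; last by do ![apply: nuM => //].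
  apply: nuB => //; apply: nuM => //; apply: nuB; first exact: nuD.
  by apply: nuM => //; apply: nuB => //; apply: nuM.
by move: e0 e2 => ? ?; nra.
Qed.

Lemma kappa_ge1 : 1 <= kappa.
Proof. by rewrite /kappa; move: e0 e2 => ? ?; nra. Qed.

Hypothesis kq1 : kappa * q < 1.
Let rho : R := kappa * q.
Let rho0 : 0 <= rho.
Proof. by rewrite mulr_ge0 ?(ltW q0) //; apply: le_trans kappa_ge1. Qed.

(** With [a = 1 - q^(m+1)] in [nu_gnum], the factor [a^2] cancels both denominators, since
    [1 - q^(m+1+k)] is at least [a]. *)
Lemma nu_gterm k n : nu (gterm k n) <= (q ^+ k * rho) ^+ n.
Proof.
rewrite /gterm; apply: le_trans (snrm_prod hnu _ _ _) _.
rewrite -[n in leRHS]card_ord -prodr_const; apply: ler_prod => m _.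
rewrite (snrm_ge0 hnu) /=.
have a0 := qX1_gt0 q0 q1 m; have b0 := qX1_gt0 q0 q1 (m + k).
have p0 := ltW (p_gt0 q1).
have hb : (1 - q ^+ (m.+1 + k))^-1 <= (1 - q ^+ m.+1)^-1.
  by rewrite (lef_pV2 b0 a0) lerD2l lerN2 ler_wiXn2l ?(ltW q0) ?(ltW q1) ?leq_addr.
have h2 : nu (gnum (q ^+ m)) <= (1 - q ^+ m.+1) ^+ 2 * (1 + 5 * e).
  apply: nu_gnum; first by rewrite exprn_ge0 ?exprn_ile1 ?ltW.
    by rewrite lerB // (qX_le q0 q1).
  by rewrite lerB // ler_wiXn2l ?ltW.
apply: (@le_trans _ _ (q ^+ k.+1 / (1 - q ^+ m.+1) * ((1 - q ^+ m.+1) ^+ 2 * (1 + 5 * e))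
   * ((1 - q ^+ m.+1)^-1 * (1 + 2 * e)))).
  apply: nuM; first apply: nuM => //.
    by apply: nuCp; rewrite divr_ge0 ?exprn_ge0 // ltW.
  apply: nuM (nu_gx _); apply: le_trans hb; apply: nuCp.
  by rewrite invr_ge0 ltW.
move: (q ^+ m.+1) a0 => v a0.
have -> : q ^+ k.+1 / (1 - v) * ((1 - v) ^+ 2 * (1 + 5 * e)) * ((1 - v)^-1 * (1 + 2 * e))
  = q ^+ k.+1 * ((1 + 5 * e) * (1 + 2 * e)) by field; rewrite gt_eqF.
rewrite exprSr -mulrA ler_wpM2l ?exprn_ge0 ?(ltW q0) // /rho mulrC ler_wpM2r ?(ltW q0) //.
rewrite /kappa ler_wpM2l //; first by move: e0 => ?; nra.
by move: e0 => ?; nra.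
Qed.

Lemma geometric_sum_le (r : R) n : 0 <= r < 1 -> \sum_(i < n) r ^+ i <= (1 - r)^-1.
Proof.
move=> /andP[r0 r1]; rewrite -[leRHS]mul1r ler_pdivlMr ?subr_gt0 // mulrC.
have -> : (1 - r) * \sum_(i < n) r ^+ i = 1 - r ^+ n.
  by rewrite -[RHS]opprB subrX1 -mulNr opprB.
by rewrite gerBl exprn_ge0.
Qed.

Lemma nu_qfacs n : nu (qfacs n) <= kappa ^+ n.
Proof.
apply: le_trans (snrm_prod hnu _ _ _) _.
rewrite -[n in leRHS]card_ord -prodr_const; apply: ler_prod => m _.
by rewrite (snrm_ge0 hnu) nu_qfac.
Qed.

(** In the boundary terms, [q^(j(M+1)) <= q^j] compensates the growth [kappa^j] of [qfacs j],
    leaving a geometric sum in [rho]. In the remainder, [gsum] minus its leading term 1 is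
    [O(q^(M+1))], against [kappa^(M+1)] from [qfacs]. *)
Lemma nu_gsum_qfacs M : nu (gsum 0 M.+1 - qfacs M.+1) <=
  (4 / (1 - q) / (1 - rho)) * rho ^+ M.+1.
Proof.
have p0 := p_gt0 q1.
have r1 : 0 < 1 - rho by rewrite subr_gt0.
have r1' : 0 <= rho <= 1 by rewrite rho0 ltW.
have hk : 0 <= kappa by apply: le_trans kappa_ge1.
have he : 1 + 2 * e <= 2 by move: e2 => ?; lra.
rewrite gsum_qfacs.
have h1 : nu (\sum_(j < M.+1) - (1 - C (q ^+ M.+1)) * (qfacs j * invy j.+1 * gterm j M.+1))
   <= \sum_(j < M.+1) (2 / (1 - q)) * rho ^+ M.+1 * rho ^+ j.
  apply: le_trans (snrm_sum hnu _ _ _) _; apply: ler_sum => j _.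
  apply: (@le_trans _ _ (1 * (kappa ^+ j * ((1 - q)^-1 * 2) * (q ^+ j * rho) ^+ M.+1))).
    apply: nuM.
      rewrite (snrmN hnu) -C1B; apply: (@le_trans _ _ (1 - q ^+ M.+1)).
        by apply: nuCp; apply: ltW; apply: qX1_gt0.
      by rewrite gerBl exprn_ge0 // ltW.
    apply: nuM (nu_gterm _ _); apply: nuM (nu_qfacs _) _.
    apply: le_trans (nu_invy _) _.
    by rewrite ler_wpM2l // invr_ge0 ltW.
  rewrite mul1r (_ : 2 / (1 - q) * rho ^+ M.+1 * rho ^+ j =
     kappa ^+ j * ((1 - q)^-1 * 2) * (q ^+ j * rho ^+ M.+1)); last first.
    by rewrite [rho ^+ j]exprMn; ring.
  rewrite ler_wpM2l ?mulr_ge0 ?exprn_ge0 ?invr_ge0 ?(ltW p0) //.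
  rewrite exprMn ler_wpM2r ?exprn_ge0 // exprS ler_piMr ?exprn_ge0 ?(ltW q0) //.
  by rewrite exprn_ile1 ?exprn_ge0 ?exprn_ile1 ?ltW.
have h2 : nu (gsum M.+1 M.+1 - 1) <= q ^+ M.+1 * (1 - rho)^-1.
  rewrite /gsum big_ord_recl {1}/gterm big_ord0 addrC addKr.
  apply: le_trans (snrm_sum hnu _ _ _) _.
  apply: (@le_trans _ _ (\sum_(j < M) q ^+ M.+1 * rho ^+ j)).
    apply: ler_sum => j _; apply: le_trans (nu_gterm _ _) _.
    rewrite lift0 exprMn; apply: ler_pM; rewrite ?exprn_ge0 ?(ltW q0) //.
      rewrite (exprS (q ^+ M.+1)) ler_piMr ?exprn_ge0 ?(ltW q0) //.
      by rewrite exprn_ile1 ?exprn_ge0 ?exprn_ile1 ?ltW.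
    by case/andP: r1' => _ r1'; rewrite ler_wiXn2l.
  rewrite -mulr_sumr ler_wpM2l ?exprn_ge0 ?(ltW q0) //.
  by apply: geometric_sum_le; rewrite rho0.
apply: (@le_trans _ _ ((2 / (1 - q)) * rho ^+ M.+1 * (1 - rho)^-1
   + kappa ^+ M.+1 * (q ^+ M.+1 * (1 - rho)^-1))).
  apply: nuD; last exact: nuM (nu_qfacs _) h2.
  apply: le_trans h1 _; rewrite -mulr_sumr ler_wpM2l //.
    by rewrite !mulr_ge0 ?exprn_ge0 ?invr_ge0 ?(ltW p0).
  by apply: geometric_sum_le; rewrite rho0.
rewrite mulrA -exprMn -/rho.
have : 1 <= (1 - q)^-1 by rewrite invf_ge1 // gerBl ltW.
have : 0 <= rho ^+ M.+1 / (1 - rho) by rewrite mulr_ge0 ?exprn_ge0 // invr_ge0 ltW.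
move: (rho ^+ M.+1) ((1 - rho)^-1) ((1 - q)^-1) => a b c ab0 c1.
by nra.
Qed.


(** * The Gauss sum as a truncated generating function *)

Definition zfac (n : nat) : K := C (q ^+ n / qnat q n ^+ 2) * gx n.
Definition step (n : nat) : K := C (qnat q n)^-1 * y + z * zfac n.
(** [n + 1] is the largest summation variable. Expanding its geometric series, [zfac] collects all
    entries [k_1 >= 2]; there is no [z] because the exponent is [s - 1]. Each smaller variable is
    absent (1), carries an entry 1 (the [y] part of [step]) or an entry at least 2 (the [z]
    part). *)
Definition Phi_trunc (M : nat) : K :=
  \sum_(n < M) zfac n.+1 * \prod_(m < n) (1 + step m.+1).

Lemma gnum_step n : gnum (q ^+ n.+1) * gx n.+1 =
  (1 - C (q ^+ n.+1)) ^+ 2 * (1 + step n.+1).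
Proof.
have u0 : 1 - q ^+ n.+1 != 0 by rewrite gt_eqF ?(qX1_gt0 q0 q1).
rewrite /gnum (@gnum_factor _ (C (qnat q n.+1)^-1) (C (tq n.+1))) ?gxK //.
- rewrite /step /zfac; congr (_ * (1 + (_ + _ * (_ * _)))).
  by rewrite -(rmorphM C) /tq; congr (C _); rewrite -mulrA -invfM -expr2.
- rewrite -C1B -(rmorphM C); congr (C _); rewrite /qnat; field.
  by rewrite u0 gt_eqF ?p_gt0.
by rewrite -C1B -!(rmorphM C) (tqE q0 q1).
Qed.

(** The numerator [gnum (q^m)] is paired by [gnum_step] with the lower factor [invx m], which
    belongs to the preceding factor of the product. *)
Lemma gterm0S n : gterm 0 n.+1 =
  (z - x * y) * (zfac n.+1 * \prod_(m < n) (1 + step m.+1)).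
Proof.
have u0 m : 1 - q ^+ m.+1 != 0 by rewrite gt_eqF ?(qX1_gt0 q0 q1).
have p0 : 1 - q != 0 by rewrite gt_eqF ?p_gt0.
elim: n => [|n IH].
  (* At [v = 1] the terms with [1 - v] vanish; this is the origin of the factor [z - xy] in the
     theorem. *)
  have G : gnum (q ^+ 0) = C (p ^+ 2) * (z - x * y).
    by rewrite /gnum expr0 (rmorph1 C) (rmorphXn C); ring.
  rewrite /gterm big_ord_recr /= !big_ord0 mul1r mulr1 G /invx /zfac addn0.
  have E : q ^+ 1 / (1 - q ^+ 1) * p ^+ 2 * (1 - q ^+ 1)^-1 = q ^+ 1 / qnat q 1 ^+ 2.
    by rewrite /qnat expr1; field; rewrite p0.
  by rewrite -E !(rmorphM C); ring.
rewrite /gterm big_ord_recr -/(gterm 0 n.+1) IH big_ord_recr /= addn0.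
rewrite /invx /zfac.
have E : q ^+ n.+2 / qnat q n.+2 ^+ 2 = q ^+ n.+1 / qnat q n.+1 ^+ 2 *
    (q ^+ 1 / (1 - q ^+ n.+2)) * (1 - q ^+ n.+2)^-1 * (1 - q ^+ n.+1) ^+ 2.
  by rewrite /qnat [q ^+ n.+2]exprS; field; rewrite p0 !u0 -exprS u0.
have := gnum_step n; rewrite -C1B -(rmorphXn C).
rewrite E !(rmorphM C).
set a := C (q ^+ n.+1) * _; set b := C (q ^+ 1) * _; set c := C (_ - _)^-1.
set d := _ * _ * (1 + _) => hg; set pr := \prod_(_ < _) _.
transitivity ((z - x * y) * (a * pr * b * c * gx n.+2) * (gnum (q ^+ n.+1) * gx n.+1)).
  by ring.
by rewrite hg /d; ring.
Qed.

Lemma gsum0E M : gsum 0 M.+1 = 1 + (z - x * y) * Phi_trunc M.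
Proof.
rewrite /gsum big_ord_recl {1}/gterm big_ord0 mulr_sumr; congr (_ + _).
by apply: eq_bigr => n _; rewrite lift0 gterm0S.
Qed.

(** The bound is uniform in [M]; it yields the convergence of all admissible zeta values. *)
Lemma nu_Phi_trunc M : nu (Phi_trunc M) <= 2 / (1 - rho).
Proof.
have hk : 0 <= kappa by apply: le_trans kappa_ge1.
have hz n : nu (zfac n.+1) <= q ^+ n.+1 * (1 + 2 * e).
  apply: nuM (nu_gx n); rewrite nuC ger0_norm; last first.
    by rewrite divr_ge0 ?exprn_ge0 ?(ltW q0) // ltW // qnat_gt0.
  rewrite ler_pdivrMr ?exprn_gt0 ?qnat_gt0 // ler_peMr ?exprn_ge0 ?(ltW q0) //.
  by rewrite exprn_ege1 // qnat_ge1.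
have hs n : nu (1 + step n.+1) <= kappa.
  apply: (@le_trans _ _ (1 + (1 * e + e * (1 * (1 + 2 * e))))).
    apply: nuD; first exact: snrm1 hnu.
    apply: nuD; apply: nuM => //.
      rewrite nuC ger0_norm ?invr_ge0 ?(ltW (qnat_gt0 _ _ _)) //.
      by rewrite invf_le1 ?qnat_gt0 ?qnat_ge1.
    apply: le_trans (hz n) _; rewrite ler_wpM2r //; first by move: e0 => ?; lra.
    by rewrite exprn_ile1 ?(ltW q0) ?(ltW q1).
  by rewrite /kappa; move: e0 e2 => ? ?; nra.
apply: le_trans (snrm_sum hnu _ _ _) _.
apply: (@le_trans _ _ (\sum_(n < M) 2 * rho ^+ n)); last first.
  rewrite -mulr_sumr ler_wpM2l //; apply: geometric_sum_le; rewrite rho0.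
  exact: kq1.
apply: ler_sum => n _.
apply: (@le_trans _ _ (q ^+ n.+1 * (1 + 2 * e) * kappa ^+ n)).
  apply: nuM => //; apply: le_trans (snrm_prod hnu _ _ _) _.
  rewrite -[X in kappa ^+ X]card_ord -prodr_const; apply: ler_prod => m _.
  by rewrite (snrm_ge0 hnu) hs.
rewrite /rho (exprMn _ kappa q) mulrAC [leLHS]mulrC (mulrC (q ^+ _)).
have h2 : 1 + 2 * e <= 2 by move: e2 => ?; lra.
have h3 : 0 <= 1 + 2 * e by move: e0 => ?; lra.
apply: ler_pM => //; first by rewrite mulr_ge0 ?exprn_ge0 ?(ltW q0).
rewrite ler_wpM2l ?exprn_ge0 // exprS ler_piMl ?exprn_ge0 ?(ltW q0) ?(ltW q1) //.
Qed.

End Gauss.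

(** * Truncated zeta values and index sets *)

Section EsumLimit.
Local Open Scope ereal_scope.

(** An unordered sum of nonnegative terms is the limit along any increasing exhaustion by finite
    lists. The bound [B] excludes an infinite sum, which [fine] would send to 0. *)
Lemma fine_esum_cvg (R : realType) (T : choiceType) (S : set T) (f : T -> R)
    (l : nat -> seq T) (B : R) :
  (forall t, S t -> (0 <= f t)%R) -> (forall M, uniq (l M)) ->
  (forall M t, t \in l M -> S t) ->
  (forall M N t, (M <= N)%N -> t \in l M -> t \in l N) ->
  (forall t, S t -> exists M, t \in l M) ->
  (forall M, (\sum_(t <- l M) f t <= B)%R) ->
  (fun M => (\sum_(t <- l M) f t)%R) @ \oo --> fine (\esum_(t in S) (f t)%:E).
Proof.
move=> f0 ul lS lmono lcov lB.
have ndec : nondecreasing_seq (fun M => (\sum_(t <- l M) f t)%R).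
  move=> M N MN; rewrite -lee_fin -!sumEFin (fsbig_seq _ _ (ul M)) (fsbig_seq _ _ (ul N)).
  apply: lee_fsum_nneg_subset => //; rewrite ?finite_seq //.
    by move=> t; rewrite !inE /=; apply: lmono.
  by move=> t; rewrite !inE /= => /andP[_ tN]; rewrite lee_fin; apply/f0/(lS N)/(set_mem tN).
have cv : cvgn (fun M => (\sum_(t <- l M) f t)%R).
  by apply: nondecreasing_is_cvgn => //; exists B => _ [M _ <-].
have le_lim M := nondecreasing_cvgn_le ndec cv M.
set L := limn _ in le_lim.
suff -> : \esum_(t in S) (f t)%:E = L%:E by [].
apply/eqP; rewrite eq_le; apply/andP; split.
  apply: ge_ereal_sup => _ [A [finA AS] <-].
  (* A finite set lies in a single [l M]: take the maximum of the indices covering its elements. *)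
  have [M AM] : exists M, forall t, A t -> t \in l M.
    case/finite_seqP: finA => s As.
    have : forall t, t \in s -> exists M, t \in l M.
      by move=> t ts; apply/lcov/AS; rewrite As.
    rewrite {}As; elim: s {AS} => [|t s IH] h; first by exists 0%N.
    have [|M hM] := IH; first by move=> u us; apply: h; rewrite inE us orbT.
    have [|N hN] := h t; first by rewrite inE eqxx.
    exists (maxn M N) => u /=; rewrite inE => /orP[/eqP ->|/hM].
      by apply: lmono hN; rewrite leq_maxr.
    by apply: lmono; rewrite leq_maxl.
  apply: (@le_trans _ _ ((\sum_(t <- l M) f t)%R)%:E); last by rewrite lee_fin.
  rewrite -sumEFin (fsbig_seq _ _ (ul M)); apply: lee_fsum_nneg_subset => //.
    by move=> t /set_mem tA; rewrite inE /=; exact: AM.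
  by move=> t; rewrite !inE /= => /andP[_ tN]; rewrite lee_fin; apply/f0/(lS M)/(set_mem tN).
have ge M : ((\sum_(t <- l M) f t)%R)%:E <= \esum_(t in S) (f t)%:E.
  apply: esum_ge; exists [set` l M]; first by split => // t /=; exact: lS.
  by rewrite -(fsbig_seq _ _ (ul M)) sumEFin.
case: (\esum_(t in S) (f t)%:E) ge => [r|_|/(_ 0%N)] //=; last by rewrite leey.
move=> ge; rewrite lee_fin; apply: limr_le => //.
by apply: nearW => M; rewrite -lee_fin.
Qed.
End EsumLimit.

Lemma big_iota0 (V : nmodType) n (F : nat -> V) :
  \sum_(i <- iota 0 n) F i = \sum_(i < n) F i.
Proof. by rewrite -(big_mkord xpredT) /index_iota subn0. Qed.

Section TruncatedZeta.
Variables (R : realType) (q : R).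
Hypotheses (q0 : 0 < q) (q1 : q < 1).

(** The sum restricted to [n_1 <= M], in nested form: the largest variable is [n + 1], so the
    remaining ones are at most [n]. *)
Fixpoint tzeta (k : seq nat) (M : nat) : R :=
  if k is k1 :: k' then
    \sum_(n < M) q ^+ (n.+1 * k1.-1) / qnat q n.+1 ^+ k1 * tzeta k' n
  else 1.

Fixpoint decseqs (r M : nat) : seq (seq nat) :=
  if r is r'.+1 then [seq n.+1 :: m | n <- iota 0 M, m <- decseqs r' n]
  else [:: [::]].

Lemma mem_decseqs r M n : (n \in decseqs r M) =
  [&& size n == r, sorted gtn n, all (leq 1) n & (head 0 n <= M)%N].
Proof.
elim: r M n => [|r IH] M n; first by case: n.
apply/allpairsPdep/idP => [[i [m [+ + ->]]]|].
  rewrite mem_iota add0n IH => /andP[_ iM] /and4P[/eqP sm dm am hm].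
  rewrite /= sm eqxx iM am /= andbT path_min_sorted // {am sm}.
  case: m dm hm => //= j m dm hm; rewrite ltnS hm /=.
  apply/allP => l lm; apply: leq_trans hm.
  move: dm; rewrite (path_sortedE (rev_trans ltn_trans)) => /andP[/allP /(_ _ lm) + _].
  exact: ltnW.
case: n => [|[|n] m] /=; [by []|by rewrite !andbF|].
move=> /and4P[/eqP[sm] dm am nM].
exists n, m; rewrite mem_iota add0n nM IH sm eqxx am (path_sorted dm) /=; split=> //.
by case: m dm {sm am} => //= j m /andP[].
Qed.

Lemma uniq_decseqs r M : uniq (decseqs r M).
Proof.
elim: r M => //= r IH M; apply: allpairs_uniq_dep => //; first exact: iota_uniq.
by move=> [i m] [j m'] _ _ [-> ->].
Qed.

Lemma tzetaE k M : tzeta k M = \sum_(n <- decseqs (size k) M) qzeta_term q k n.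
Proof.
elim: k M => [|k1 k IH] M; first by rewrite big_seq1 /qzeta_term big_nil.
rewrite /= big_allpairs_dep big_iota0.
apply: eq_bigr => n _; rewrite IH mulr_sumr; apply: eq_bigr => m _.
by rewrite /qzeta_term /= big_cons.
Qed.

Lemma qzeta_term_ge0 k n : 0 <= qzeta_term q k n.
Proof.
apply: prodr_ge0 => i _; rewrite divr_ge0 ?exprn_ge0 ?(ltW q0) //.
rewrite divr_ge0 ?subr_ge0 ?(ltW q1) //.
by apply: exprn_ile1; apply: ltW.
Qed.

Lemma tzeta_ge0 k M : 0 <= tzeta k M.
Proof. by rewrite tzetaE sumr_ge0 // => n _; exact: qzeta_term_ge0. Qed.

Lemma tzeta_cvg k B : (forall M, tzeta k M <= B) -> tzeta k @ \oo --> qzeta q k.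
Proof.
move=> hB; rewrite (_ : tzeta k = (fun M => \sum_(n <- decseqs (size k) M) qzeta_term q k n)).
  apply: (@fine_esum_cvg _ _ _ _ _ B).
  - by move=> t _; exact: qzeta_term_ge0.
  - by move=> M; exact: uniq_decseqs.
  - by move=> M t; rewrite mem_decseqs => /and4P[h1 h2 h3 _] /=; rewrite h1 h2 h3.
  - move=> M N t MN; rewrite !mem_decseqs => /and4P[-> -> -> h] /=.
    exact: leq_trans MN.
  - by move=> t /= /and3P[s1 s2 s3]; exists (head 0%N t); rewrite mem_decseqs s1 s2 s3 /=.
  - by move=> M; rewrite -tzetaE.
by apply/funext => M; rewrite tzetaE.
Qed.
End TruncatedZeta.

(** Indices with [b] entries 1, [c] entries at least 2 and weight [a + b + 2 c], so that [a], [b],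
    [c] are exponents of [x], [y], [z]. The depth [d], meant to be [b + c], carries the
    recursion. *)
Fixpoint indices (d a b c : nat) : seq (seq nat) :=
  if d is d'.+1 then
    (if b is b'.+1 then [seq 1%N :: k | k <- indices d' a b' c] else [::]) ++
    (if c is c'.+1 then [seq i.+2 :: k | i <- iota 0 a.+1, k <- indices d' (a - i) b c']
     else [::])
  else if (a + b + c == 0)%N then [:: [::]] else [::].

Definition adm_indices (a b c : nat) : seq (seq nat) :=
  [seq i.+2 :: k | i <- iota 0 a.+1, k <- indices (b + c) (a - i) b c].

Lemma indicesS d a b c : indices d.+1 a b c =
  (if b is b'.+1 then [seq 1%N :: k | k <- indices d a b' c] else [::]) ++
  (if c is c'.+1 then [seq i.+2 :: k | i <- iota 0 a.+1, k <- indices d (a - i) b c']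
   else [::]).
Proof. by []. Qed.

Lemma mem_indices d a b c (k : seq nat) : d = (b + c)%N ->
  (k \in indices d a b c) =
  [&& is_index k, depth k == d, height k == c & weight k == (a + d + c)%N].
Proof.
elim: d a b c k => [|d IH] a b c k dbc.
  have -> : b = 0%N by lia. have -> : c = 0%N by lia.
  rewrite /= !addn0; case: k => [|k1 k]; first by rewrite /= /weight /=; case: a.
  by rewrite /depth /= andbF; case: ifP.
rewrite indicesS mem_cat; apply/orP/idP => [[]|].
- case: b dbc => // b dbc /mapP[k' + ->]; rewrite IH; last lia.
  rewrite /is_index /depth /height /weight /= => /and4P[-> /eqP -> /eqP -> /eqP ->].
  by rewrite /= !eqxx; lia.
- case: c dbc => // c dbc /allpairsPdep[i [k' [+ + ->]]].
  rewrite mem_iota IH; last lia.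
  rewrite /is_index /depth /height /weight /= => hi /and4P[-> /eqP -> /eqP -> /eqP ->].
  by rewrite /= !eqxx; lia.
rewrite /is_index /depth /height /weight.
case: k => [|[|[|i]] k] /and4P[h1 h2 h3 h4] //.
  rewrite /= in h1 h2 h3 h4; case: b dbc => [|b] dbc.
    have := count_size (leq 2) k; lia.
  left; apply/mapP; exists k => //.
  rewrite IH; last lia.
  by rewrite /is_index /depth /height /weight h1 /=; lia.
rewrite /= in h1 h2 h3 h4; case: c dbc h3 h4 => [|c] dbc h3 h4; first by lia.
right; apply/allpairsPdep; exists i, k.
(* Entries at least 2 count twice on the left; this bounds the excess [i] of the first entry by
   [a]. *)
have hw : (size k + count (leq 2) k <= sumn k)%N.
  elim: k h1 {h2 h3 h4} => //= j k IHk /andP[j0 /IHk]; case: j j0 => [|[|j]] //=; lia.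
have hi : (i <= a)%N by lia.
split=> //; first by rewrite mem_iota.
rewrite IH; last lia.
by rewrite /is_index /depth /height /weight h1 /=; lia.
Qed.

Lemma uniq_indices d a b c : uniq (indices d a b c).
Proof.
elim: d a b c => [|d IH] a b c; first by rewrite /=; case: ifP.
rewrite indicesS cat_uniq; apply/and3P; split.
- by case: b => // b; rewrite map_inj_uniq // => k k' [].
- apply/hasPn => k0; case: c => [|c] // /allpairsPdep[i [k [_ _ ->]]].
  by case: b => // b; apply/negP => /mapP[].
case: c => // c; apply: allpairs_uniq_dep => //; first exact: iota_uniq.
by move=> [i m] [j m'] _ _ [-> ->].
Qed.

(** [adm_indices a b c] is the second half of [indices (b + c).+1 a b c.+1]; the first half consists
    of indices beginning with 1. *)
Lemma mem_adm_indices a b c (k : seq nat) : (k \in adm_indices a b c) =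
  [&& admissible k, weight k == (a + b + c + c + 2)%N, depth k == (b + c + 1)%N
    & height k == c.+1].
Proof.
have := @mem_indices (b + c).+1 a b c.+1 k (esym (addnS b c)).
rewrite indicesS mem_cat -/(adm_indices a b c) /admissible => h.
have nh : admissible k -> k \notin (if b is b'.+1 then
    [seq 1%N :: k | k <- indices (b + c) a b' c.+1] else [::]).
  case: b {h} => // b /andP[_ hk]; apply/negP => /mapP[k' _ kE].
  by rewrite kE in hk.
apply/idP/idP => [kk|].
  have hh : (1 < head 0 k)%N by case/allpairsPdep: kk => i [k' [_ _ ->]].
  move: h; rewrite kk orbT => /esym /and4P[-> h2 h3 h4].
  by rewrite hh /=; lia.
move=> /and4P[/[dup] adm /andP[h1 h2] h3 h4 h5].
move: h; rewrite (negbTE (nh adm)) orFb => ->.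
by rewrite h1 /=; lia.
Qed.

Lemma adm_indicesE a b c :
  [set` adm_indices a b c] = admissible_set (a + b + c + c + 2) (b + c + 1) (c + 1).
Proof.
apply/seteqP; split=> k /=; rewrite mem_adm_indices.
  by case/and4P => ? /eqP ? /eqP ? /eqP ?; split => //; lia.
by case=> -> -> -> ->; rewrite !eqxx addn1 eqxx.
Qed.

Lemma uniq_adm_indices a b c : uniq (adm_indices a b c).
Proof.
apply: allpairs_uniq_dep => //; first exact: iota_uniq.
  by move=> i _; exact: uniq_indices.
by move=> [i m] [j m'] _ _ [-> ->].
Qed.

Lemma qzeta_sum_adm_indices (R : realType) (q : R) a b c :
  qzeta_sum q (a + b + c + c + 2) (b + c + 1) (c + 1) =
  \sum_(k <- adm_indices a b c) qzeta q k.
Proof. by rewrite /qzeta_sum -adm_indicesE -fsbig_seq // uniq_adm_indices. Qed.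

Lemma Phi0_coef (R : realType) (q : R) a b c :
  Phi0 q a b c = \sum_(k <- adm_indices a b c) qzeta q k.
Proof.
(* The solution of [k - r - s = a], [r - s = b], [s - 1 = c]: the only triple contributing to this
   monomial. *)
pose t0 := ((a + b + c + c + 2)%N, (b + c + 1)%N, (c + 1)%N).
rewrite -qzeta_sum_adm_indices.
transitivity (\sum_(t \in [set t0]) Phi0_term q t a b c).
  rewrite /Phi0 [LHS]/=; apply/esym/fsbig_widen => // -[[k r] s] [_ /= tt0].
  rewrite fps3_monomial.
  have [ [i iA] | nA] := pselect (exists i, admissible_set k r s i).
    have [h1 h2 h3] := admissible_set_bounds iA.
    case: and3P => [[/eqP ha /eqP hb /eqP hc]|]; last by rewrite mulr0.
    by case: tt0; rewrite /t0; congr (_, _, _); lia.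
  rewrite /qzeta_sum (_ : admissible_set k r s = set0) ?fsbig_set0 ?mul0r //.
  by apply/seteqP; split => // i iA; case: nA; exists i.
rewrite fsbig_set1 fps3_monomial.
rewrite (_ : [&& _, _ & _]) ?mulr1 //; apply/and3P; split; apply/eqP; lia.
Qed.

(** * Coefficients of the truncated generating function *)

Lemma fps_geoE (S : comNzRingType) (c : S) n : fps_geo c n = c ^+ n.
Proof. by []. Qed.

Section Coefficients.
Variable R : comNzRingType.
Implicit Types f : fps3 R.

Lemma fps3CM_coef s f a b c : (fps3C s * f) a b c = s * f a b c.
Proof. by rewrite /fps3C !fpsCM_coef. Qed.

Lemma fps3_sumE (I : Type) (r : seq I) (P : pred I) (F : I -> fps3 R) a b c :
  (\sum_(i <- r | P i) F i) a b c = \sum_(i <- r | P i) F i a b c.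
Proof. by apply: (big_morph (fun f : fps3 R => f a b c)). Qed.

Lemma fpsXM_coef (S : comNzRingType) (f : fps S) n :
  (fpsX S * f) n = if n is n'.+1 then f n' else 0.
Proof.
rewrite fpsME; case: n => [|n]; first by rewrite big_ord1 mul0r.
rewrite big_ord_recl big_ord_recl big1 => [|i _]; last by rewrite mul0r.
by rewrite mul0r mul1r add0r addr0 subSS subn0.
Qed.

Lemma fps3yM_coef f a b c :
  (fps3y * f) a b c = if b is b'.+1 then f a b' c else 0.
Proof. by rewrite /fps3y fpsCM_coef fpsXM_coef; case: b. Qed.

Lemma fps3zM_coef f a b c :
  (fps3z * f) a b c = if c is c'.+1 then f a b c' else 0.
Proof. by rewrite /fps3z !fpsCM_coef fpsXM_coef; case: c. Qed.

Lemma geoxM_coef t f a b c :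
  (geox t * f) a b c = \sum_(i < a.+1) t ^+ i * f (a - i)%N b c.
Proof.
rewrite /geox fpsME !fps_sumE; apply: eq_bigr => i _.
by rewrite fps_geoE !fpsCX !fpsCM_coef.
Qed.
End Coefficients.

(** The expanded product is sorted by the largest index [n] at which [s n] is chosen, which matches
    the recursion of [tzeta]. *)
Lemma prod_1D_recl (K : comNzRingType) (s : nat -> K) M :
  \prod_(m < M) (1 + s m) = 1 + \sum_(n < M) s n * \prod_(m < n) (1 + s m).
Proof.
elim: M => [|M IH]; first by rewrite !big_ord0 addr0.
by rewrite big_ord_recr [in RHS]big_ord_recr /= addrA -IH mulrDr mulr1 mulrC.
Qed.

Section PhiTrunc.
Variables (R : realType) (q : R).

Let C : {rmorphism R -> fps3 R} := @fps3C R.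
Let gx n := geox (tq q n).

Lemma zfacM_coef n f a b c : (zfac q C gx n * f) a b c =
  \sum_(i < a.+1) q ^+ (n * i.+1) / qnat q n ^+ i.+2 * f (a - i)%N b c.
Proof.
rewrite /zfac -mulrA fps3CM_coef geoxM_coef mulr_sumr; apply: eq_bigr => i _.
rewrite [LHS]mulrA; congr (_ * _); rewrite /tq; move: (qnat q n) => s.
by rewrite exprMn exprVn mulrACA -exprM -exprD -invfM -exprD mulnS add2n.
Qed.

(** Induction on the depth: by [prod_1D_recl] the factor at the largest index splits off a first
    entry 1 through [y], or [i + 2] through [z] and the power [x^i]. *)
Lemma prod_step_coef d M a b c : d = (b + c)%N ->
  (\prod_(m < M) (1 + step q C fps3y fps3z gx m.+1)) a b c =
  \sum_(k <- indices d a b c) tzeta q k M.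
Proof.
elim: d M a b c => [|d IH] M a b c dbc.
  have -> : b = 0%N by lia. have -> : c = 0%N by lia.
  rewrite (prod_1D_recl (fun m => step q C fps3y fps3z gx m.+1)) !fpsDE fps3_sumE big1 => [|n _].
    by rewrite addr0 /= !addn0; case: a => [|a]; rewrite ?big_seq1 ?big_nil.
  by rewrite /step mulrDl -mulrA !fpsDE fps3CM_coef -mulrA fps3yM_coef fps3zM_coef mulr0 addr0.
have one0 : (1 : fps3 R) a b c = 0.
  by case: a b c dbc => [|a] [|b] [|c].
rewrite (prod_1D_recl (fun m => step q C fps3y fps3z gx m.+1)) !fpsDE fps3_sumE.
rewrite one0 add0r indicesS big_cat.
transitivity (\sum_(n < M) (
   (if b is b'.+1 then (qnat q n.+1)^-1 * \sum_(k <- indices d a b' c) tzeta q k n else 0)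
   + (if c is c'.+1 then \sum_(i < a.+1) q ^+ (n.+1 * i.+1) / qnat q n.+1 ^+ i.+2 *
        \sum_(k <- indices d (a - i) b c') tzeta q k n else 0))).
  apply: eq_bigr => n _.
  rewrite /step mulrDl -mulrA !fpsDE fps3CM_coef -mulrA fps3yM_coef fps3zM_coef.
  congr (_ + _).
    by case: b dbc {one0} => [|b] dbc; rewrite ?mulr0 // IH //; lia.
  case: c dbc {one0} => [|c] dbc //; rewrite zfacM_coef; apply: eq_bigr => i _.
  by rewrite IH //; lia.
rewrite big_split; congr (_ + _).
  case: b {dbc one0} => [|b]; first by rewrite /= big_nil big1.
  rewrite big_map; under eq_bigr do rewrite mulr_sumr.
  rewrite exchange_big; apply: eq_bigr => k _; apply: eq_bigr => n _.
  by rewrite /= muln0 expr0 expr1 mul1r.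
case: c {dbc one0} => [|c]; first by rewrite /= big_nil big1.
rewrite big_allpairs_dep big_iota0.
rewrite exchange_big; apply: eq_bigr => i _.
under eq_bigr do rewrite mulr_sumr.
by rewrite exchange_big.
Qed.

Lemma Phi_trunc_coef M a b c :
  Phi_trunc q C fps3y fps3z gx M a b c = \sum_(k <- adm_indices a b c) tzeta q k M.
Proof.
rewrite /Phi_trunc fps3_sumE big_allpairs_dep big_iota0.
transitivity (\sum_(n < M) \sum_(i < a.+1) \sum_(k <- indices (b + c) (a - i) b c)
  q ^+ (n.+1 * i.+1) / qnat q n.+1 ^+ i.+2 * tzeta q k n).
  apply: eq_bigr => n _; rewrite zfacM_coef; apply: eq_bigr => i _.
  by rewrite (prod_step_coef _ _ (erefl (b + c)%N)) mulr_sumr.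
rewrite exchange_big; apply: eq_bigr => i _.
by rewrite exchange_big.
Qed.
End PhiTrunc.

(** * Power sums and derivations *)

Section CompleteSymmetric.
Variable S : comNzRingType.
Implicit Type e : S.

(* [csym e1 e2 n] is the complete symmetric polynomial of degree [n - 1] in
   [alpha, beta], and 0 for [n = 0]. *)
Fixpoint csym2 e1 e2 (n : nat) : S * S :=
  if n is n'.+1 then let: (k, k') := csym2 e1 e2 n' in (k', e1 * k' - e2 * k)
  else (0, 1).
Definition csym e1 e2 n : S := (csym2 e1 e2 n).1.

Lemma csymSS e1 e2 n : csym e1 e2 n.+2 = e1 * csym e1 e2 n.+1 - e2 * csym e1 e2 n.
Proof. by rewrite /csym /=; case: (csym2 e1 e2 n). Qed.

Lemma powsum_csym e1 e2 n :
  powsum e1 e2 n = csym e1 e2 n.+1 *+ 2 - e1 * csym e1 e2 n.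
Proof.
elim/ltn_ind: n => -[_|[_|n IH]].
- by rewrite mulr0 subr0.
- by rewrite csymSS /csym /= mulr1 mulr0 subr0 mulr2n addrK.
rewrite powsumSS !IH // [csym _ _ n.+3]csymSS [csym _ _ n.+2]csymSS.
by rewrite !mulr2n; ring.
Qed.

(* [n * lpow] is the derivative of [powsum], when [d1], [d2] are those of [e1], [e2]. *)
Definition lpow e1 e2 (d1 d2 : S) n : S :=
  if n is n'.+1 then d1 * csym e1 e2 n - d2 * csym e1 e2 n' else 0.

Lemma lpow1 e1 e2 d1 d2 : lpow e1 e2 d1 d2 1 = d1.
Proof. by rewrite /lpow /csym /= mulr1 mulr0 subr0. Qed.

Lemma lpow2 e1 e2 d1 d2 : lpow e1 e2 d1 d2 2 = e1 * d1 - d2.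
Proof. by rewrite /lpow /csym /= mulr1 mulr0 subr0 mulr1 mulrC. Qed.

Lemma lpowSSS e1 e2 d1 d2 n : lpow e1 e2 d1 d2 n.+3 =
  e1 * lpow e1 e2 d1 d2 n.+2 - e2 * lpow e1 e2 d1 d2 n.+1.
Proof.
by rewrite /lpow [csym _ _ n.+3]csymSS [csym _ _ n.+2]csymSS; ring.
Qed.

(** The last two terms on the right are what truncation leaves of the recurrence [lpowSSS]; their
    order grows with [n]. *)
Lemma lpow_gen_trunc e1 e2 d1 d2 t n :
  (1 - t * e1 + t ^+ 2 * e2) * \sum_(i < n.+2) t ^+ i * lpow e1 e2 d1 d2 i =
  t * d1 - t ^+ 2 * d2 - t ^+ n.+2 * lpow e1 e2 d1 d2 n.+2
  + t ^+ n.+3 * e2 * lpow e1 e2 d1 d2 n.+1.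
Proof.
elim: n => [|n IH].
  rewrite !big_ord_recr big_ord0 /= -/(lpow _ _ _ _ 1) -/(lpow _ _ _ _ 2).
  by rewrite lpow1 lpow2 mulr0 !add0r; ring.
rewrite big_ord_recr mulrDr IH lpowSSS.
by move: (lpow _ _ _ _ n.+1) (lpow _ _ _ _ n.+2) => a b /=; rewrite !exprS; ring.
Qed.

(** The partial derivatives of the power sum [p_n] in [e1] and [e2] are [n h_(n-1)] and
    [- n h_(n-2)], with [h] the complete symmetric polynomials; the proof uses only the
    recurrences. *)
Lemma derivation_powsum e1 e2 (D : {additive S -> S}) n :
  (forall a b, D (a * b) = D a * b + a * D b) ->
  D (powsum e1 e2 n) = lpow e1 e2 (D e1) (D e2) n *+ n.
Proof.
move=> DM; have D1 : D 1 = 0.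
  by have := DM 1 1; rewrite !mulr1 mul1r => /esym/eqP; rewrite -subr_eq0 addrK => /eqP.
elim/ltn_ind: n => -[_|[_|n IH]].
- by rewrite mulr0n /powsum /= (raddfMn D 2 1) D1 mul0rn.
- by rewrite lpow1 mulr1n.
rewrite powsumSS raddfB !DM !IH //.
case: n IH => [|n] _.
  by rewrite lpow1 lpow2 mulr0n /powsum /= !mulr2n mulr1n; ring.
have E : D e1 * powsum e1 e2 n.+2 - D e2 * powsum e1 e2 n.+1 =
    e1 * lpow e1 e2 (D e1) (D e2) n.+2 - e2 * lpow e1 e2 (D e1) (D e2) n.+1 *+ 2.
  by rewrite !powsum_csym /lpow [csym _ _ n.+3]csymSS [csym _ _ n.+2]csymSS !mulr2n; ring.
rewrite lpowSSS.
move: (lpow _ _ _ _ n.+2) (lpow _ _ _ _ n.+1) E => a b E.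
transitivity ((D e1 * powsum e1 e2 n.+2 - D e2 * powsum e1 e2 n.+1) +
  (e1 * a *+ n.+2 - e2 * b *+ n.+1)); first by rewrite !mulrnAr; ring.
by rewrite E !mulrS !mulrnDl !mulNrn mulr0n; ring.
Qed.
End CompleteSymmetric.

(** * The Euler derivation *)

Section Order.
Variable R : comNzRingType.
Implicit Types f g e : fps3 R.

Lemma fps3_eq_order f g : (forall d, fps3_order_ge d (f - g)) -> f = g.
Proof.
move=> h; apply: fpsP => a; apply: fpsP => b; apply: fpsP => c.
apply/eqP; rewrite -subr_eq0; apply/eqP.
by have := h (a + b + c).+1 a b c (leqnn _); rewrite fps3D fps3N.
Qed.

Lemma fps3_order_geB d f g :
  fps3_order_ge d f -> fps3_order_ge d g -> fps3_order_ge d (f - g).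
Proof. by move=> hf hg; apply: fps3_order_geD => //; apply: fps3_order_geN. Qed.

Lemma fps3_order_geMr d f g : fps3_order_ge d f -> fps3_order_ge d (f * g).
Proof. by rewrite mulrC; apply: fps3_order_geMl. Qed.

(** The order is only about half the index, because [e2] raises the index by 2 but the order
    possibly by no more than 1. *)
Lemma fps3_order_ge_csym e1 e2 n :
  fps3_order_ge 1 e1 -> fps3_order_ge 1 e2 -> fps3_order_ge (uphalf n.-1) (csym e1 e2 n).
Proof.
move=> h1 h2; elim/ltn_ind: n => -[_|[_|[_|n] IH]] //; rewrite csymSS.
  by apply: fps3_order_geB => //; apply: fps3_order_geMr.
apply: fps3_order_geB.
  apply: (@fps3_order_geW _ _ (1 + uphalf n.+1)); first by rewrite /=; lia.
  by apply: fps3_order_geM => //; apply: (IH n.+2).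
apply: (@fps3_order_geW _ _ (1 + uphalf n)); first by rewrite /=; lia.
by apply: fps3_order_geM => //; apply: (IH n.+1).
Qed.

Lemma fps3_order_ge_lpow e1 e2 d1 d2 n :
  fps3_order_ge 1 e1 -> fps3_order_ge 1 e2 ->
  fps3_order_ge 1 d1 -> fps3_order_ge 1 d2 ->
  fps3_order_ge (uphalf n) (lpow e1 e2 d1 d2 n).
Proof.
move=> h1 h2 h3 h4; case: n => [|n] //; rewrite /lpow; apply: fps3_order_geB.
  apply: (@fps3_order_geW _ _ (1 + uphalf n)); first by rewrite /=; lia.
  by apply: fps3_order_geM => //; apply: (@fps3_order_ge_csym e1 e2 n.+1).
apply: (@fps3_order_geW _ _ (1 + uphalf n.-1)); first by rewrite /=; lia.
by apply: fps3_order_geM => //; apply: (@fps3_order_ge_csym e1 e2 n).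
Qed.

Lemma fps3_sum_coef (P : pred nat) (F : nat -> fps3 R) L a b c :
  (forall n, P n -> fps3_order_ge (uphalf n) (F n)) -> ((a + b + c).*2 < L)%N ->
  fps3_sum [set n | P n] F a b c = \sum_(n < L | P n) F n a b c.
Proof.
move=> hF hL; rewrite /fps3_sum /=.
rewrite -(big_mkord P (fun n => F n a b c)) -[RHS]big_filter [RHS]fsbig_seq; last first.
  by rewrite filter_uniq // iota_uniq.
apply: esym; apply: fsbig_widen.
  by move=> n /=; rewrite mem_filter => /andP[].
move=> n /= [Pn]; rewrite mem_filter Pn mem_index_iota /= => /negP.
by rewrite -leqNgt => Ln; apply: hF => //; lia.
Qed.

Lemma fps3_sum_order (P : pred nat) (F : nat -> fps3 R) L d :
  (forall n, P n -> fps3_order_ge (uphalf n) (F n)) -> (d.*2 <= L)%N ->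
  fps3_order_ge d (fps3_sum [set n | P n] F - \sum_(n < L | P n) F n).
Proof.
move=> hF hL a b c abc; rewrite fps3D fps3N (@fps3_sum_coef P F L) //; last by lia.
by rewrite fps3_sumE subrr.
Qed.
End Order.

Lemma setT_nat : [set: nat] = [set n | xpredT n].
Proof. by apply/seteqP; split. Qed.

Section Theta.
Variable R : comNzRingType.
Implicit Types f g : fps3 R.

Definition theta f : fps3 R := fps3_of (fun a b c => f a b c *+ (a + b + c)).

Lemma theta_is_zmod_morphism : zmod_morphism theta.
Proof.
move=> f g; apply: fpsP => a; apply: fpsP => b; apply: fpsP => c.
by rewrite !fpsBE /theta /= -mulrnBl.
Qed.

HB.instance Definition _ :=
  GRing.isZmodMorphism.Build (fps3 R) (fps3 R) theta theta_is_zmod_morphism.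

Lemma thetaE f a b c : theta f a b c = f a b c *+ (a + b + c).
Proof. by []. Qed.

Lemma thetaM f g : theta (f * g) = theta f * g + f * theta g.
Proof.
have key (u v : R) m n : (u * v) *+ (m + n) = (u *+ m) * v + u * (v *+ n).
  by rewrite mulrnDr mulrnAl mulrnAr.
apply: fpsP => a; apply: fpsP => b; apply: fpsP => c.
apply: (etrans (congr1 (fun v => v *+ (a + b + c)) (fps3M f g a b c))).
apply: (etrans _ (esym (congr2 +%R (fps3M (theta f) g a b c) (fps3M f (theta g) a b c)))).
rewrite -sumrMnl -[RHS]big_split.
apply: eq_bigr => i _.
rewrite -sumrMnl -[RHS]big_split; apply: eq_bigr => j _.
rewrite -sumrMnl -[RHS]big_split; apply: eq_bigr => l _.
apply: (etrans _ (key _ _ (i + j + l) ((a - i) + (b - j) + (c - l)))%N).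
congr (_ *+ _).
by move: (ltn_ord i) (ltn_ord j) (ltn_ord l); lia.
Qed.

Lemma theta1 : theta 1 = 0.
Proof.
have := thetaM 1 1; rewrite !mulr1 mul1r => /esym/eqP.
by rewrite -subr_eq0 addrK => /eqP.
Qed.

Lemma theta_CM s f : theta (fps3C s * f) = fps3C s * theta f.
Proof.
apply: fpsP => a; apply: fpsP => b; apply: fpsP => c.
by rewrite (thetaE (_ * f) a b c) !fps3CM_coef (thetaE f a b c) mulrnAr.
Qed.

Lemma theta_exp f n : theta (f ^+ n.+1) = theta f * f ^+ n *+ n.+1.
Proof.
elim: n => [|n IH]; first by rewrite mulr1.
rewrite exprS thetaM IH [in RHS]mulrS mulrnAr; congr (_ + _).
by rewrite mulrCA -exprS.
Qed.

Lemma fps3_order_ge_theta d f : fps3_order_ge d f -> fps3_order_ge d (theta f).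
Proof. by move=> hf a b c abc; rewrite (thetaE f a b c) hf // mul0rn. Qed.
End Theta.

(** * The exponential and the equation [theta G = W G] *)

Section ThetaExp.
Variable R : realType.
Implicit Types F : fps3 R.

Lemma theta_fps3_exp F : F 0 0 0 = 0 -> theta (fps3_exp F) = theta F * fps3_exp F.
Proof.
move=> F0; apply: fps3_eq_order => d.
have hF : fps3_order_ge 1 F by move=> [|a] // [|b] // [|c].
pose T j := fps3C (j`!%:R^-1) * F ^+ j.
have hT j : xpredT j -> fps3_order_ge (uphalf j) (T j).
  move=> _; apply: fps3_order_geMl; apply: (@fps3_order_geW _ _ j); first by lia.
  exact: fps3_order_geX.
(* Differentiation sends the term [j + 1] to [theta F] times the term [j], so one more term is
   needed on the left. *)
have E L : theta (\sum_(j < L.+1) T j) = theta F * \sum_(j < L) T j.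
  rewrite big_ord_recl raddfD /= /T expr0 mulr1 fact0 invr1 (rmorph1 (@fps3C R)) theta1 add0r.
  rewrite raddf_sum mulr_sumr; apply: eq_bigr => j _ /=.
  rewrite -[bump 0 j]/(j.+1) theta_CM theta_exp mulrnAr -mulrnAl.
  have -> : fps3C (j.+1`!%:R^-1) *+ j.+1 = fps3C (j`!%:R^-1 : R).
    rewrite -(rmorphMn (@fps3C R)) -mulr_natl factS natrM invfM mulrA.
    by rewrite mulfV ?mul1r // pnatr_eq0.
  by rewrite mulrCA.
rewrite /fps3_exp setT_nat -/T.
set S := fps3_sum _ _; pose L := d.*2.
have h1 : fps3_order_ge d (S - \sum_(j < L.+1) T j) by apply: fps3_sum_order => //; lia.
have h2 : fps3_order_ge d (S - \sum_(j < L) T j) by apply: fps3_sum_order => //; lia.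
have -> : theta S - theta F * S = theta (S - \sum_(j < L.+1) T j)
   - theta F * (S - \sum_(j < L) T j).
  by rewrite raddfB /= E mulrBr opprB addrA subrK.
exact: (fps3_order_geB (fps3_order_ge_theta h1) (fps3_order_geMl (theta F) h2)).
Qed.

Lemma fps3_exp_coef0 F : F 0 0 0 = 0 -> fps3_exp F 0 0 0 = 1.
Proof.
move=> F0; have hF : fps3_order_ge 1 F by move=> [|a] // [|b] // [|c].
rewrite /fps3_exp setT_nat (@fps3_sum_coef _ _ _ 1) //.
  by rewrite big_ord1 fps3CM_coef fact0 invr1 mul1r.
move=> j _; apply: fps3_order_geMl; apply: (@fps3_order_geW _ _ j); first by lia.
exact: fps3_order_geX.
Qed.

Lemma cvgn_sum (I : Type) (r : seq I) (P : pred I) (F : I -> nat -> R) (l : I -> R) :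
  (forall i, P i -> F i @ \oo --> l i) ->
  (fun M => \sum_(i <- r | P i) F i M) @ \oo --> \sum_(i <- r | P i) l i.
Proof.
move=> hF; apply: cvg_big => //; exact: add_continuous.
Qed.

(* The equation [theta G = W * G] determines the coefficients of [G] recursively,
   and continuously in [W]. *)
Lemma theta_eq_cvg (G W : nat -> fps3 R) (G' W' : fps3 R) :
  (forall M, theta (G M) = W M * G M) -> theta G' = W' * G' ->
  (forall M, G M 0%N 0%N 0%N = 1) -> G' 0%N 0%N 0%N = 1 ->
  (forall M, W M 0%N 0%N 0%N = 0) -> W' 0%N 0%N 0%N = 0 ->
  (forall a b c, W M a b c @[M --> \oo] --> W' a b c) ->
  forall a b c, G M a b c @[M --> \oo] --> G' a b c.
Proof.
move=> hG hG' G1 G1' W0 W0' hW a b c.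
have [d hd] : exists d, (a + b + c = d)%N by eexists.
elim/ltn_ind: d a b c hd => -[_|d IH] a b c hd.
  have [-> -> ->] : [/\ a = 0, b = 0 & c = 0]%N by split; lia.
  by under eq_fun do rewrite G1; rewrite G1'; exact: cvg_cst.
have -> : G' a b c = d.+1%:R^-1 * (W' * G') a b c.
  by rewrite -hG' (thetaE G' a b c) hd -(mulr_natl (G' a b c)) mulKf // pnatr_eq0.
have -> : (fun M => G M a b c) = (fun M => d.+1%:R^-1 * (W M * G M) a b c).
  apply/funext => M; rewrite -hG (thetaE (G M) a b c) hd -(mulr_natl (G M a b c)).
  by rewrite mulKf // pnatr_eq0.
apply: cvgM; first exact: cvg_cst.
rewrite fps3M; under eq_fun do rewrite fps3M.
apply: cvgn_sum => i _; apply: cvgn_sum => j _; apply: cvgn_sum => l _.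
have [ijl|ijl] := posnP (i + j + l).
  have [-> -> ->] : [/\ (i : nat) = 0, (j : nat) = 0 & (l : nat) = 0]%N by split; lia.
  by under eq_fun do rewrite W0 mul0r; rewrite W0' mul0r; exact: cvg_cst.
apply: cvgM; first exact: hW.
move: (ltn_ord i) (ltn_ord j) (ltn_ord l) => hi hj hl.
apply: (IH (d.+1 - (i + j + l))%N); lia.
Qed.
End ThetaExp.

(** * The exponent *)

Section LogDerivative.
Variable R : comNzRingType.
Implicit Types e : fps3 R.

(* The logarithmic derivative of [1 / (1 - t e1 + t^2 e2)]. *)
Definition dlog e1 e2 (t : R) : fps3 R :=
  fps3_sum [set n | xpredT n]
    (fun n => fps3C t ^+ n * lpow e1 e2 (theta e1) (theta e2) n).

Lemma dlog_order e1 e2 t n : fps3_order_ge 1 e1 -> fps3_order_ge 1 e2 ->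
  fps3_order_ge (uphalf n) (fps3C t ^+ n * lpow e1 e2 (theta e1) (theta e2) n).
Proof.
move=> h1 h2; apply: fps3_order_geMl.
by apply: fps3_order_ge_lpow => //; apply: fps3_order_ge_theta.
Qed.

(** [lpow_gen_trunc] with [2 d + 2] terms: the tail and both remainders have order at least [d]. *)
Lemma dlogE e1 e2 t : fps3_order_ge 1 e1 -> fps3_order_ge 1 e2 ->
  (1 - fps3C t * e1 + fps3C t ^+ 2 * e2) * dlog e1 e2 t =
  fps3C t * theta e1 - fps3C t ^+ 2 * theta e2.
Proof.
move=> h1 h2; apply: fps3_eq_order => d.
have hs : fps3_order_ge d (dlog e1 e2 t - \sum_(i < d.*2.+2)
    fps3C t ^+ i * lpow e1 e2 (theta e1) (theta e2) i).
  apply: (@fps3_sum_order _ xpredT); last lia.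
  by move=> n _; apply: dlog_order.
have := lpow_gen_trunc e1 e2 (theta e1) (theta e2) (fps3C t) d.*2.
have := fps3_order_geMl (1 - fps3C t * e1 + fps3C t ^+ 2 * e2) hs.
have o1 : fps3_order_ge d (fps3C t ^+ d.*2.+2 * lpow e1 e2 (theta e1) (theta e2) d.*2.+2).
  by apply: fps3_order_geW (@dlog_order e1 e2 t d.*2.+2 h1 h2); lia.
have o2 : fps3_order_ge d (fps3C t ^+ d.*2.+3 * e2 * lpow e1 e2 (theta e1) (theta e2) d.*2.+1).
  apply: fps3_order_geMl; apply: (@fps3_order_geW _ _ (uphalf d.*2.+1)); first by lia.
  by apply: fps3_order_ge_lpow => //; apply: fps3_order_ge_theta.
move: o1 o2 {hs}; set A := _ * lpow _ _ _ _ _; set B := _ * _ * lpow _ _ _ _ _.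
set S := \sum_(i < _) _; move: (1 - _ + _) => D o1 o2 hs E.
have -> : D * dlog e1 e2 t - (fps3C t * theta e1 - fps3C t ^+ 2 * theta e2) =
    D * (dlog e1 e2 t - S) - A + B.
  rewrite mulrBr E; move: (D * _) (_ - _ * theta e2) => u v; ring.
exact: fps3_order_geD (fps3_order_geB hs o1) o2.
Qed.

Lemma dlog_coef e1 e2 t L a b c : fps3_order_ge 1 e1 -> fps3_order_ge 1 e2 ->
  ((a + b + c).*2 < L)%N ->
  dlog e1 e2 t a b c =
  \sum_(n < L) t ^+ n * lpow e1 e2 (theta e1) (theta e2) n a b c.
Proof.
move=> h1 h2 hL; rewrite /dlog (@fps3_sum_coef _ _ _ L) //; last first.
  by move=> n _; apply: dlog_order.
by apply: eq_bigr => n _; rewrite -(rmorphXn (@fps3C R)) fps3CM_coef.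
Qed.

Lemma theta_quadratic e1 e2 t :
  theta (1 - fps3C t * e1 + fps3C t ^+ 2 * e2) =
  - (fps3C t * theta e1 - fps3C t ^+ 2 * theta e2).
Proof.
rewrite -(rmorphXn (@fps3C R)) raddfD raddfB /= theta1 !theta_CM sub0r opprD opprK.
by [].
Qed.

(** [u] and [v] are the logarithmic derivatives of [1 / f] and [1 / g], as [dlog] provides them, and
    the product is [f / g]. *)
Lemma derivation_ratio (S : comNzRingType) (D : {additive S -> S}) (f g g' u v : S) :
  (forall a b, D (a * b) = D a * b + a * D b) -> D 1 = 0 ->
  g * g' = 1 -> f * u = - D f -> g * v = - D g -> D (f * g') = (v - u) * (f * g').
Proof.
move=> DM D1 gg' hf hg.
have hg' : D g' = g' * v.
  have : D (g * g') = 0 by rewrite gg'.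
  rewrite DM => /eqP; rewrite addr_eq0 => /eqP E.
  have F : g * D g' = g * v * g' by rewrite hg mulNr E opprK.
  transitivity (g' * (g * D g')); first by rewrite mulrA (mulrC g') gg' mul1r.
  transitivity ((g * g') * (g' * v)); first by rewrite F; ring.
  by rewrite gg' mul1r.
rewrite DM hg' -[D f]opprK -hf; ring.
Qed.
End LogDerivative.

(** * The factors of the product, and the logarithmic derivative of the exponential *)

Section QFactor.
Variables (R : realType) (q : R).
Local Notation x := (@fps3x R).
Local Notation y := (@fps3y R).
Local Notation z := (@fps3z R).
Local Notation C := (@fps3C R).

Definition e1fps : fps3 R := x + y + C (q - 1) * (z - x * y).
Definition qratio (t : R) : fps3 R :=
  (1 - C t * e1fps + C t ^+ 2 * z) * (geox t * geoy t).
Definition dlog_qratio (t : R) : fps3 R := dlog (x + y) (x * y) t - dlog e1fps z t.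

Lemma xy_order : fps3_order_ge 1 (x + y).
Proof. by apply: fps3_order_geD; [exact: fps3_order_gex|exact: fps3_order_gey]. Qed.

Lemma xMy_order : fps3_order_ge 1 (x * y).
Proof. by apply: fps3_order_geMr; exact: fps3_order_gex. Qed.

Lemma e1fps_order : fps3_order_ge 1 e1fps.
Proof.
apply: fps3_order_geD; first exact: xy_order.
by apply/fps3_order_geMl/fps3_order_geB; [exact: fps3_order_gez|exact: xMy_order].
Qed.

Lemma quadratic_geoK t : (1 - C t * (x + y) + C t ^+ 2 * (x * y)) * (geox t * geoy t) = 1.
Proof.
have := geoxK t; have := geoyK t.
move: (geox t) (geoy t) (C t) x y => g h s u v Eh Eg.
transitivity (((1 - s * u) * g) * ((1 - s * v) * h)); first by ring.
by rewrite Eg Eh mulr1.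
Qed.

Lemma theta_qratio t : theta (qratio t) = dlog_qratio t * qratio t.
Proof.
have E e1 e2 : fps3_order_ge 1 e1 -> fps3_order_ge 1 e2 ->
    (1 - C t * e1 + C t ^+ 2 * e2) * dlog e1 e2 t = - theta (1 - C t * e1 + C t ^+ 2 * e2).
  by move=> h1 h2; rewrite theta_quadratic opprK dlogE.
have Ee := E _ _ e1fps_order (@fps3_order_gez R); have Ex := E _ _ xy_order xMy_order.
exact: (derivation_ratio (@thetaM R) (theta1 R) (quadratic_geoK t) Ee Ex).
Qed.

(** At [t = q - 1] the terms in [z] cancel and numerator and denominator agree; the particular form
    of [alpha + beta] enters here. *)
Lemma dlog_qratio_qB1 : dlog_qratio (q - 1) = 0.
Proof.
have D1 := dlogE (q - 1) xy_order xMy_order.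
have D2 := dlogE (q - 1) e1fps_order (@fps3_order_gez R).
have E : 1 - C (q - 1) * e1fps + C (q - 1) ^+ 2 * z =
         1 - C (q - 1) * (x + y) + C (q - 1) ^+ 2 * (x * y).
  by rewrite /e1fps; move: (C _) x y z => s u v w; ring.
have := quadratic_geoK (q - 1); rewrite E in D2.
have T := congr1 (@theta R) E; rewrite !theta_quadratic in T.
move: T => /oppr_inj T; rewrite T -D1 in D2.
rewrite /dlog_qratio.
move: (1 - _ + _) (geox _ * geoy _) (dlog _ _ _) (dlog _ _ _) D2 => a g u v D2 ag.
by rewrite -[u - v]mul1r -ag (mulrC a) -mulrA mulrBr D2 subrr mulr0.
Qed.

Let lpow_diff n a b c : R := lpow (x + y) (x * y) (theta (x + y)) (theta (x * y)) n a b c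
  - lpow e1fps z (theta e1fps) (theta z) n a b c.

Lemma dlog_qratio_coef t L a b c : ((a + b + c).*2 < L)%N ->
  dlog_qratio t a b c = \sum_(n < L) t ^+ n * lpow_diff n a b c.
Proof.
move=> hL.
apply: (etrans (congr2 (fun u v => u - v) (dlog_coef t xy_order xMy_order hL)
  (dlog_coef t e1fps_order (@fps3_order_gez R) hL))).
by rewrite -sumrB; apply: eq_bigr => n _; rewrite -mulrBr.
Qed.

Lemma dlog_qratio000 t : dlog_qratio t 0%N 0%N 0%N = 0.
Proof.
by rewrite (@dlog_qratio_coef t 1) // big_ord1 /lpow_diff subrr mulr0.
Qed.

Lemma lpow_diff_eq0 n a b c : ((a + b + c).*2 < n)%N -> lpow_diff n a b c = 0.
Proof.
move=> hn; have hn' : (a + b + c < uphalf n)%N by lia.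
have h1 := fps3_order_ge_lpow (n := n) xy_order xMy_order
  (fps3_order_ge_theta xy_order) (fps3_order_ge_theta xMy_order).
have h2 := fps3_order_ge_lpow (n := n) e1fps_order (@fps3_order_gez R)
  (fps3_order_ge_theta e1fps_order) (fps3_order_ge_theta (@fps3_order_gez R)).
apply: (etrans (congr2 (fun u v => u - v) (h1 a b c hn') (h2 a b c hn'))).
exact: subrr.
Qed.

Hypotheses (q0 : 0 < q) (q1 : q < 1).

(* [\sum_(2 <= n <= N) q^(j(n-1)) / [j]^n (q-1)^(N-n)] is a geometric sum. *)
Lemma zeta_term_sum j N :
  \sum_(n < N.+2 | (2 <= n)%N) q ^+ (j.+1 * n.-1) / qnat q j.+1 ^+ n * (q - 1) ^+ (N.+1 - n)
  = tq q j.+1 ^+ N.+1 + tq q j.+1 / (1 - q) * (q - 1) ^+ N.+1.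
Proof.
have p0 : 1 - q != 0 by rewrite gt_eqF ?p_gt0.
have u0 : 1 - q ^+ j.+1 != 0 by rewrite gt_eqF ?qX1_gt0.
elim: N => [|N IH].
  rewrite big1 => [|i]; last by case: i => -[|[|]].
  by rewrite !expr1; field.
rewrite big_mkcond big_ord_recr /= -big_mkcond /= subnn expr0 mulr1.
under eq_bigr => n _.
  rewrite subSn ?exprS; last by rewrite -ltnS.
  rewrite mulrCA; over.
rewrite -mulr_sumr IH.
have -> : q ^+ (j.+1 * N.+1) / qnat q j.+1 ^+ N.+2 = tq q j.+1 ^+ N.+1 / qnat q j.+1.
  rewrite /tq; move: (qnat q j.+1) => s.
  by rewrite exprM exprMn exprVn -mulrA -invfM -exprSr.
rewrite !exprS /tq /qnat; field.
by rewrite p0 u0.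
Qed.

(** Reindexing by [N = m + n]; the terms with [N >= L] vanish, so both sums can stop at [L]. *)
Lemma shifted_sum (V : nmodType) (g : nat -> nat -> V) n L : (n <= L)%N ->
  (forall m N, (L <= N)%N -> g m N = 0) ->
  \sum_(m < L) g m (m + n)%N = \sum_(N < L | (n <= N)%N) g (N - n)%N N.
Proof.
move=> nL g0.
rewrite -(big_mkord (fun N => (n <= N)%N) (fun N => g (N - n)%N N)).
rewrite -(big_mkord xpredT (fun m => g m (m + n)%N)).
have -> : \sum_(0 <= m < L) g m (m + n)%N = \sum_(n <= N < L + n) g (N - n)%N N.
  rewrite -{2}(add0n n) big_addn addnK; apply: eq_bigr => m _.
  by rewrite addnK.
rewrite (@big_cat_nat _ _ _ L n (L + n)) ?leq_addr //=.
rewrite [X in _ + X]big_nat_cond [X in _ + X]big1 ?addr0; last first.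
  by move=> N /andP[/andP[LN _] _]; exact: g0.
rewrite [RHS](@big_cat_nat _ _ _ n 0 L) //= [X in _ = X + _]big_nat_cond.
rewrite [X in _ = X + _]big1 ?add0r; last first.
  by move=> N; lia.
by rewrite big_nat_cond [RHS]big_nat_cond; apply: eq_bigl => N; lia.
Qed.

Definition exponent : fps3 R :=
  fps3_sum [set n : nat | (2 <= n)%N] (fun n : nat =>
    C (qzeta q [:: n]) *
    fps3_sum [set: nat] (fun m : nat =>
      C ((q - 1) ^+ m / (m + n)%:R) *
      (x ^+ (m + n) + y ^+ (m + n) - powsum e1fps z (m + n)))).

Lemma fps3_mulrnE (f : fps3 R) n a b c : (f *+ n) a b c = f a b c *+ n.
Proof. by elim: n => [|n IH] //; rewrite !mulrS -IH. Qed.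

Lemma theta_powsum_diff n a b c :
  (x ^+ n + y ^+ n - powsum e1fps z n) a b c *+ (a + b + c) = lpow_diff n a b c *+ n.
Proof.
have E : theta (x ^+ n + y ^+ n - powsum e1fps z n) =
    (lpow (x + y) (x * y) (theta (x + y)) (theta (x * y)) n
     - lpow e1fps z (theta e1fps) (theta z) n) *+ n.
  rewrite -powsumE raddfB mulrnBl; congr (_ - _);
  exact: derivation_powsum (@thetaM R).
exact: (etrans (congr1 (fun f : fps3 R => f a b c) E) (fps3_mulrnE _ n a b c)).
Qed.

(** The denominator [m + n] of the exponent cancels the multiple produced by [derivation_powsum]. *)
Lemma theta_exponent_coef L a b c : ((a + b + c).*2 < L)%N ->
  theta exponent a b c = \sum_(n < L | (2 <= n)%N) qzeta q [:: val n] *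
    \sum_(m < L) (q - 1) ^+ m * lpow_diff (m + n) a b c.
Proof.
move=> hL; rewrite (thetaE exponent a b c) /exponent.
pose u (n m : nat) : R := (q - 1) ^+ m / (m + n)%:R.
pose v (n : nat) : R := qzeta q [:: n].
have ho n := outer_order_ge u v e1fps_order (@fps3_order_gez R) (n := n).
have hi n m := inner_order_ge u e1fps_order (@fps3_order_gez R) (n := n) (m := m).
have E := @fps3_sum_coef R (fun n => 2 <= n)%N _ L a b c (fun n _ => ho n) hL.
rewrite [X in X *+ _](_ : _ = \sum_(n < L | (2 <= n)%N) v n * \sum_(m < L)
   u n m * (x ^+ (m + n) + y ^+ (m + n) - powsum e1fps z (m + n)) a b c); last first.
  apply: (etrans E); apply: eq_bigr => n _; rewrite fps3CM_coef; congr (_ * _).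
  rewrite setT_nat.
  have hi' m : xpredT m -> fps3_order_ge (uphalf m) (fps3C (u n m) *
      (x ^+ (m + n) + y ^+ (m + n) - powsum e1fps z (m + n))).
    by move=> _; apply: fps3_order_geW (hi n m); lia.
  apply: (etrans (@fps3_sum_coef R xpredT _ L a b c hi' hL)).
  by apply: eq_bigr => m _; rewrite fps3CM_coef.
rewrite -sumrMnl; apply: eq_bigr => n n2; rewrite -mulrnAr; congr (_ * _).
rewrite -sumrMnl; apply: eq_bigr => m _; rewrite -mulrnAr theta_powsum_diff.
rewrite /u -[lpow_diff _ _ _ _ *+ _]mulr_natl mulrA divfK // pnatr_eq0; lia.
Qed.

Lemma lpow_diff0 a b c : lpow_diff 0 a b c = 0.
Proof. exact: subrr. Qed.

Lemma dlog_qratio_zeta_terms j L a b c : ((a + b + c).*2 < L)%N ->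
  dlog_qratio (tq q j.+1) a b c =
  \sum_(n < L | (2 <= n)%N) q ^+ (j.+1 * n.-1) / qnat q j.+1 ^+ n *
    \sum_(m < L) (q - 1) ^+ m * lpow_diff (m + n) a b c.
Proof.
move=> hL; pose zt (n : nat) : R := q ^+ (j.+1 * n.-1) / qnat q j.+1 ^+ n.
transitivity (\sum_(N < L)
    (\sum_(n < N.+1 | (2 <= n)%N) zt n * (q - 1) ^+ (N - n)) * lpow_diff N a b c).
  (* The added multiple of [dlog_qratio (q - 1)] is zero, and completes [t^N] to the right side of
     [zeta_term_sum]. *)
  transitivity (dlog_qratio (tq q j.+1) a b c
      + tq q j.+1 / (1 - q) * dlog_qratio (q - 1) a b c).
    by rewrite dlog_qratio_qB1 mulr0 addr0.
  apply: (etrans (congr2 (fun u v => u + tq q j.+1 / (1 - q) * v)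
    (dlog_qratio_coef (tq q j.+1) hL) (dlog_qratio_coef (q - 1) hL))).
  rewrite mulr_sumr -big_split; apply: eq_bigr => N _ /=.
  (* [zeta_term_sum] starts at exponent 1; for [N = 0] the factor [lpow_diff] vanishes. *)
  rewrite mulrA -mulrDl; case: (nat_of_ord N) => [|N']; first by rewrite lpow_diff0 !mulr0.
  by rewrite zeta_term_sum.
transitivity (\sum_(n < L | (2 <= n)%N) \sum_(N < L | (n <= N)%N)
    zt n * (q - 1) ^+ (N - n) * lpow_diff N a b c).
  rewrite (exchange_big_dep xpredT) //=; apply: eq_bigr => N _.
  rewrite (big_ord_widen_cond L (fun n => 2 <= n)%N (fun n => zt n * (q - 1) ^+ (N - n))) //.
  by rewrite mulr_suml; apply: eq_bigl => n; rewrite ltnS.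
apply: eq_bigr => n _.
rewrite (@shifted_sum _ (fun m N => (q - 1) ^+ m * lpow_diff N a b c)) ?mulr_sumr //.
- by apply: eq_bigr => N _; rewrite mulrA.
- exact: ltnW.
by move=> m N LN; rewrite lpow_diff_eq0 ?mulr0 //; apply: leq_trans LN.
Qed.

(** For a fixed monomial only finitely many [n] and [m] occur, and summing over [j] first gives
    [tzeta q [:: n] M]. *)
Lemma dlog_qratio_sum_cvg :
  (forall n, (2 <= n)%N -> tzeta q [:: n] @ \oo --> qzeta q [:: n]) ->
  forall a b c,
  (\sum_(j < M) dlog_qratio (tq q j.+1)) a b c @[M --> \oo] --> theta exponent a b c.
Proof.
move=> hz a b c; pose L := (a + b + c).*2.+1.
rewrite (@theta_exponent_coef L) //.
have -> : (fun M => (\sum_(j < M) dlog_qratio (tq q j.+1)) a b c) =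
    (fun M => \sum_(n < L | (2 <= n)%N) tzeta q [:: val n] M *
       \sum_(m < L) (q - 1) ^+ m * lpow_diff (m + n) a b c).
  apply/funext => M; rewrite fps3_sumE.
  transitivity (\sum_(j < M) \sum_(n < L | (2 <= n)%N)
      q ^+ (j.+1 * n.-1) / qnat q j.+1 ^+ n * \sum_(m < L) (q - 1) ^+ m * lpow_diff (m + n) a b c).
    by apply: eq_bigr => j _; exact: dlog_qratio_zeta_terms.
  rewrite exchange_big; apply: eq_bigr => n _; rewrite -mulr_suml; congr (_ * _).
  by rewrite /=; apply: eq_bigr => j _; rewrite mulr1.
by apply: cvgn_sum => n n2; apply: cvgM; [exact: hz|exact: cvg_cst].
Qed.

Lemma fps3M000 (f g : fps3 R) :
  (f * g) 0%N 0%N 0%N = f 0%N 0%N 0%N * g 0%N 0%N 0%N.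
Proof. by rewrite fps3M !big_ord1. Qed.

Lemma qratio000 t : qratio t 0%N 0%N 0%N = 1.
Proof.
have h : fps3_order_ge 1 (- (C t * e1fps) + C t ^+ 2 * z).
  apply: fps3_order_geD; last exact/fps3_order_geMl/fps3_order_gez.
  exact/fps3_order_geN/fps3_order_geMl/e1fps_order.
rewrite /qratio fps3M000 -addrA fps3D h // addr0.
apply: (etrans (mul1r _)).
have E : geox t 0%N 0%N 0%N * geoy t 0%N 0%N 0%N = 1 by exact: mulr1.
exact: (etrans (fps3M000 (geox t) (geoy t)) E).
Qed.

Lemma prod_qratio_cvg :
  (forall n, (2 <= n)%N -> tzeta q [:: n] @ \oo --> qzeta q [:: n]) ->
  forall a b c,
  (\prod_(j < M) qratio (tq q j.+1)) a b c @[M --> \oo] --> fps3_exp exponent a b c.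
Proof.
move=> hz; have E0 : exponent 0%N 0%N 0%N = 0.
  exact: (outer_coef0 (fun n m => (q - 1) ^+ m / (m + n)%:R) (fun n => qzeta q [:: n])
    e1fps_order (@fps3_order_gez R)).
apply: (@theta_eq_cvg _ _ (fun M => \sum_(j < M) dlog_qratio (tq q j.+1)) _ (theta exponent)).
- elim=> [|M IH]; first by rewrite !big_ord0 theta1 mul0r.
  by rewrite !big_ord_recr /= thetaM IH theta_qratio; ring.
- exact: theta_fps3_exp.
- move=> M; elim: M => [|M IH]; first by rewrite big_ord0.
  rewrite big_ord_recr; apply: (etrans (fps3M000 _ _)).
  by rewrite IH qratio000 mulr1.
- exact: fps3_exp_coef0.
- by move=> M; rewrite fps3_sumE big1 // => j _; exact: dlog_qratio000.
- by rewrite (thetaE exponent) mulr0n.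
- exact: dlog_qratio_sum_cvg.
Qed.
End QFactor.

(** * Limits *)

Section Limits.
Variables (R : realType) (q : R).
Hypotheses (q0 : 0 < q) (q1 : q < 1).
Local Notation x := (@fps3x R).
Local Notation y := (@fps3y R).
Local Notation z := (@fps3z R).
Let C : {rmorphism R -> fps3 R} := @fps3C R.
Let gx n := geox (tq q n).
Let gy n := geoy (tq q n).

Let gxK n : (1 - C (tq q n.+1) * x) * gx n.+1 = 1. Proof. exact: geoxK. Qed.
Let gyK n : (1 - C (tq q n.+1) * y) * gy n.+1 = 1. Proof. exact: geoyK. Qed.

(* Any weight small enough to make [kappa e * q < 1] would do. *)
Let e : R := (1 - q) / 52.

Let e_gt0 : 0 < e. Proof. by rewrite divr_gt0 // subr_gt0. Qed.
Let e_ge0 : 0 <= e. Proof. exact: ltW. Qed.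
Let e_le : 2 * e <= 1. Proof. by rewrite /e; move: q0 => ?; lra. Qed.
Let kq1 : kappa e * q < 1.
Proof.
(* [kappa e = 1 + 9 e + 24 e^2 + 20 e^3], with [e^2 <= e / 2] and [e^3 <= e / 4]. Then
   [26 e = (1 - q) / 2], and [(1 + (1 - q) / 2) q < 1] amounts to [(1 - q) (2 - q) > 0]. *)
have h : kappa e <= 1 + 26 * e.
  rewrite /kappa; move: e e_ge0 e_le => v v0 v1.
  have v2 : 2 * (v * v) <= v by nra.
  have v3 : 4 * (v * v * v) <= v by nra.
  by nra.
apply: (@le_lt_trans _ _ ((1 + 26 * e) * q)); first by rewrite ler_wpM2r // ltW.
by rewrite /e; move: q0 q1 => ? ?; nra.
Qed.

Let nu D := nrm3 e D.
Let hnu D : seminorm (nu D). Proof. exact: nrm3_seminorm. Qed.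
Let nuC D c : nu D (C c) = `|c|. Proof. exact: nrm3C. Qed.
Let nux D : nu D x <= e. Proof. exact: nrm3x. Qed.
Let nuy D : nu D y <= e. Proof. exact: nrm3y. Qed.
Let nuz D : nu D z <= e. Proof. exact: nrm3z. Qed.

Lemma coef_le_nu (f : fps3 R) a b c :
  `|f a b c| <= nu (a + b + c) f / e ^+ (a + b + c).
Proof. by rewrite ler_pdivlMr ?exprn_gt0 //; apply: coef_le_nrm3 => //; lia. Qed.

(** A coefficient of [Phi_trunc] is a sum of nonnegative truncated zeta values, so its uniform bound
    holds for each of them. *)
Lemma tzeta_bounded a b c :
  exists B, forall k : seq nat, k \in adm_indices a b c -> forall M, tzeta q k M <= B.
Proof.
set d := (a + b + c)%N.
exists (2 / (1 - kappa e * q) / e ^+ d) => k kin M.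
have h := nu_Phi_trunc q0 q1 gxK (hnu d) (nuC d) e_ge0 e_le (nux d) (nuy d) (nuz d) kq1 M.
apply: (@le_trans _ _ (nu d (Phi_trunc q C y z gx M) / e ^+ d)); last first.
  by rewrite ler_wpM2r // invr_ge0 exprn_ge0.
apply: le_trans (coef_le_nu _ _ _ _); apply: le_trans (ler_norm _).
rewrite Phi_trunc_coef (big_rem k kin) /= lerDl.
by apply: sumr_ge0 => k' _; exact: tzeta_ge0.
Qed.

Lemma tzeta_adm_cvg a b c (k : seq nat) : k \in adm_indices a b c -> tzeta q k @ \oo --> qzeta q k.
Proof.
move=> kin; have [B hB] := tzeta_bounded a b c.
by apply: (tzeta_cvg q0 q1 (B := B)); exact: hB.
Qed.

Lemma Phi_trunc_cvg a b c :
  Phi_trunc q C y z gx M a b c @[M --> \oo] --> Phi0 q a b c.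
Proof.
rewrite Phi0_coef; under eq_fun do rewrite Phi_trunc_coef big_seq.
by rewrite big_seq; apply: cvgn_sum => k; exact: tzeta_adm_cvg.
Qed.

Lemma gsum_cvg_Phi0 a b c :
  gsum q C x y z gx 0 M.+1 a b c @[M --> \oo] --> (1 + (z - x * y) * Phi0 q) a b c.
Proof.
have -> : (fun M => gsum q C x y z gx 0 M.+1 a b c) =
    (fun M => (1 : fps3 R) a b c + ((z - x * y) * Phi_trunc q C y z gx M) a b c).
  by apply/funext => M; rewrite (gsum0E q0 q1 y z gxK).
apply: cvgD; first exact: cvg_cst.
rewrite fps3M; under eq_fun do rewrite fps3M.
apply: cvgn_sum => i _; apply: cvgn_sum => j _; apply: cvgn_sum => l _.
by apply: cvgM; [exact: cvg_cst|exact: Phi_trunc_cvg].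
Qed.

(** The degree of truncation in the seminorm stays at [a + b + c] while [M] grows, so
    [nu_gsum_qfacs] bounds the coefficient by a constant times [rho^(M+1)]. *)
Lemma gsum_sub_qfacs_cvg a b c :
  (gsum q C x y z gx 0 M.+1 - qfacs q C x y z gx gy M.+1) a b c @[M --> \oo] --> (0 : R).
Proof.
set d := (a + b + c)%N; set rho := kappa e * q.
have rho0 : 0 <= rho.
  by rewrite mulr_ge0 ?(ltW q0) //; apply: le_trans (kappa_ge1 e_ge0 e_le).
pose B := 4 / (1 - q) / (1 - rho) / e ^+ d.
apply/norm_cvg0P; apply: (@squeeze_cvgr _ _ _ _ (cst 0) (fun M => B * rho ^+ M.+1)).
- apply: nearW => M; apply/andP; split; first exact: normr_ge0.
  apply: (le_trans (coef_le_nu (gsum q C x y z gx 0 M.+1 - qfacs q C x y z gx gy M.+1) a b c)).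
  rewrite /B mulrAC ler_wpM2r ?invr_ge0 ?exprn_ge0 //.
  exact: nu_gsum_qfacs.
- exact: cvg_cst.
rewrite -[0](mulr0 B); apply: cvgM; first exact: cvg_cst.
have h : `|rho| < 1 by rewrite ger0_norm.
by have := cvg_expr h; rewrite -cvg_shiftS.
Qed.

Lemma gsum_cvg_exp a b c :
  gsum q C x y z gx 0 M.+1 a b c @[M --> \oo] --> fps3_exp (exponent q) a b c.
Proof.
have hz n : (2 <= n)%N -> tzeta q [:: n] @ \oo --> qzeta q [:: n].
  (* The index [(n)] is the one belonging to the monomial [x^(n-2)] of [Phi0]. *)
  move=> n2; apply: (@tzeta_adm_cvg (n - 2) 0 0).
  rewrite mem_adm_indices /admissible /is_index /weight /depth /height /= n2.
  by rewrite !andbT; lia.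
have -> : (fun M => gsum q C x y z gx 0 M.+1 a b c) =
    (fun M => (gsum q C x y z gx 0 M.+1 - qfacs q C x y z gx gy M.+1) a b c
       + qfacs q C x y z gx gy M.+1 a b c).
  by apply/funext => M; rewrite fps3D fps3N subrK.
rewrite -[fps3_exp _ a b c]add0r; apply: cvgD; first exact: gsum_sub_qfacs_cvg.
(* [qfac] at index [j + 1] is, by conversion, [qratio (tq q j.+1)]. *)
by have := @prod_qratio_cvg R q q0 q1 hz a b c; rewrite -cvg_shiftS.
Qed.
End Limits.

Theorem theorem3 (R : realType) (q : R) (hq0 : 0 < q) (hq1 : q < 1) :
  let x : fps3 R := fps3x in
  let y : fps3 R := fps3y in
  let z : fps3 R := fps3z in
  let e1 : fps3 R := x + y + fps3C (q - 1) * (z - x * y) in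
  let e2 : fps3 R := z in
  1 + (z - x * y) * Phi0 q =
  fps3_exp
    (fps3_sum [set n : nat | (2 <= n)%N] (fun n : nat =>
       fps3C (qzeta q [:: n]) *
       fps3_sum [set: nat] (fun m : nat =>
         fps3C ((q - 1) ^+ m / (m + n)%:R) *
         (x ^+ (m + n) + y ^+ (m + n) - powsum e1 e2 (m + n))))).
Proof.
move=> x y z e1 e2; apply: fpsP => a; apply: fpsP => b; apply: fpsP => c.
have h1 := @gsum_cvg_Phi0 R q hq0 hq1 a b c; have h2 := @gsum_cvg_exp R q hq0 hq1 a b c.
exact: (norm_cvg_unique h1 h2).
Qed.
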